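(* The non-atomic ergodic (invariant Borel probability) measures for the Delannoy adic dynamical system are a one-parameter family $\{\mu_\alpha:\alpha\in[0,1]\}$ given by choosing nonnegative $\alpha,\beta,\gamma$ with $\alpha+\beta+\gamma=1$ and $\beta\gamma=\alpha$, and then putting weight $\beta$ on each horizontal edge, weight $\gamma$ on each vertical edge, and weight $\alpha$ on each diagonal edge of the Delannoy graph. (The measure of any cylinder set is then determined by multiplying the weights on the edges that define it.)
   Context: **Delannoy graph.** The directed graph with vertex set $\mathbb{Z}_{\ge 0}^2$, root $(0,0)$, and, for all $n,k\ge 0$, exactly one (horizontal) edge from $(n,k)$ to $(n+1,k)$, one (vertical) edge to $(n,k+1)$ and one (diagonal) edge to $(n+1,k+1)$. The three edges entering a vertex $(n+1,k+1)$ with $n,k\ge 0$ are ordered so that the one from $(n+1,k)$ is first, the one from $(n,k)$ is second, and the one from $(n,k+1)$ is last. Inserting an extra vertex at the center of each square, on its diagonal edge, makes this graph a Bratteli diagram with the same space of infinite paths from the root. **Path space.** $X$ is the set of infinite directed paths starting at $(0,0)$. Writing $e_i(x)$, $i\ge 1$, for the successive edges of $x$, labeled $h$, $v$ or $d$ (horizontal, vertical, diagonal), $X$ has the compact topology generated by the cylinder sets $[a_1\dots a_I]=\{x\in X: e_i(x)=a_i \text{ for all } i\le I\}$ with $a_i\in\{h,d,v\}$. **Adic transformation.** Two paths are tail equivalent if they coincide from some point on, that is, if they have a common vertex after which they follow the same edges. For distinct tail equivalent $x,y$, let $w$ be the first such vertex, and put $x<y$ if the edge by which $x$ enters $w$ precedes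 the edge by which $y$ enters $w$. $X_{\max}$ (resp. $X_{\min}$) is the set of paths that include only maximal (resp. minimal) edges, in the order on edges entering each vertex. The adic transformation $T:X\setminus X_{\max}\to X\setminus X_{\min}$ sends $x$ to the smallest $y$ with $y>x$; $T$ and $T^{-1}$ are defined to be the identity on each of the (countable) sets $X_{\max}$ and $X_{\min}$. The pair $(X,T)$ is the Delannoy adic dynamical system. **Measures.** Invariant and ergodic mean $T$-invariant and ergodic for $T$. For an invariant measure, all cylinder sets determined by initial path segments from the root to a fixed vertex have the same measure. Non-atomic means that every single point has measure $0$.
   Formalization: The members with α = 0 are excluded from the non-atomic family, since they are point masses on the all-horizontal or all-vertical path; and the parameter running over [0,1] is β, because α does not take all values in [0,1] and does not determine β and γ. *)

(* Defs.v *)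
From HB Require Import structures.
From mathcomp Require Import all_boot all_order all_algebra.
From mathcomp Require Import all_classical all_reals all_analysis.
Set Implicit Arguments.
Unset Strict Implicit.
Unset Printing Implicit Defensive.
Import Order.TTheory GRing.Theory Num.Theory.
Local Open Scope classical_set_scope.

Inductive edge := Horizontal | Diagonal | Vertical.

HB.instance Definition _ := gen_eqMixin edge.
HB.instance Definition _ := gen_choiceMixin edge.
HB.instance Definition _ := isPointed.Build edge Horizontal.

Definition target (w : nat * nat) (e : edge) : nat * nat :=
  match e with
  | Horizontal => (w.1.+1, w.2)
  | Diagonal => (w.1.+1, w.2.+1)
  | Vertical => (w.1, w.2.+1)
  end.

(* Every vertex has exactly one outgoing edge of each kind, so an infinite
   path from the root is the same as an infinite word in the edge labels.
   Edges are numbered from 0: [x i] is e_(i+1)(x). *)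
Definition dpath := nat -> edge.

HB.instance Definition _ := Choice.on dpath.
HB.instance Definition _ := isPointed.Build dpath (fun=> Horizontal).

Definition cylinder (s : seq edge) : set dpath :=
  [set x | mkseq x (size s) = s].

HB.instance Definition _ := isPointed.Build (seq edge) [::].
HB.instance Definition _ :=
  @isSubBaseTopological.Build dpath (seq edge) setT cylinder.

Definition X := g_sigma_algebraType (@open dpath).

Fixpoint vertex (x : dpath) (i : nat) : nat * nat :=
  if i is j.+1 then target (vertex x j) (x j) else (0, 0).

Definition enters (e : edge) (w : nat * nat) : Prop :=
  exists u, target u e = w.

(* Position of an edge in the order on the edges entering a given vertex: into
   (n+1, k+1), the edge from (n+1, k) is vertical, the edge from (n, k) is
   diagonal and the edge from (n, k+1) is horizontal. *)
Definition rank (e : edge) : nat :=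
  match e with Vertical => 0 | Diagonal => 1 | Horizontal => 2 end.

Definition maximal_edge (e : edge) (w : nat * nat) : Prop :=
  forall f, enters f w -> rank f <= rank e.

Definition X_max : set dpath :=
  [set x | forall i, maximal_edge (x i) (vertex x i.+1)].

(* The vertex reached by x after i edges and by y after j edges is the same, and
   x and y follow the same edges from there on. The indices i and j may differ,
   since a diagonal edge joins the same vertices as two other edges. *)
Definition merged (x y : dpath) (i j : nat) : Prop :=
  vertex x i = vertex y j /\ forall k, x (i + k) = y (j + k).

(* Tail equivalence is the existence of i and j with [merged x y i j]; here
   [vertex x i.+1] is the first vertex after which x and y coincide. *)
Definition adic_lt (x y : dpath) : Prop :=
  exists i j, [/\ merged x y i.+1 j.+1,
    forall i' j', merged x y i' j' -> i.+1 <= i'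
    & rank (x i) < rank (y j)].

Definition is_successor (x y : dpath) : Prop :=
  adic_lt x y /\ forall z, adic_lt x z -> z = y \/ adic_lt y z.

(* Outside [X_max] the successor exists and is unique, so the default value of
   [xget] is not used. *)
Definition adic (x : dpath) : dpath :=
  if `[< X_max x >] then x else xget x [set y | is_successor x y].

Local Open Scope ring_scope.
Local Open Scope ereal_scope.

Definition invariant_measure (R : realType) (mu : probability X R) : Prop :=
  forall A : set X, measurable A -> mu (adic @^-1` A) = mu A.

Definition ergodic_measure (R : realType) (mu : probability X R) : Prop :=
  forall A : set X, measurable A -> adic @^-1` A = A -> mu A = 0 \/ mu A = 1.

Definition nonatomic (R : realType) (mu : probability X R) : Prop :=
  forall x : X, mu [set x] = 0.

Local Close Scope ereal_scope.

(* The weight of diagonal edges is a, of horizontal edges b, of vertical edges c.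
   The constraints leave one degree of freedom, b in [0, 1], with
   c = (1 - b) / (1 + b). If a = 0, then b or c is 1 and the measure is a point
   mass on a horizontal or vertical path. *)
Definition admissible (R : realType) (a b c : R) : Prop :=
  [/\ 0 <= a, 0 <= b, 0 <= c, a + b + c = 1 & b * c = a].

Definition weight (R : realType) (a b c : R) (e : edge) : R :=
  match e with Horizontal => b | Vertical => c | Diagonal => a end.

Definition given_by_weights (R : realType) (mu : probability X R)
    (a b c : R) : Prop :=
  forall s : seq edge, mu (cylinder s) = (\prod_(e <- s) weight a b c e)%:E.

(* Main.v *)
From HB Require Import structures.
Require Import Defs.
From mathcomp Require Import all_boot all_order all_algebra.
From mathcomp Require Import all_classical all_reals all_analysis.
From mathcomp Require Import finmap zify ring lra.
Import Order.TTheory GRing.Theory Num.Theory.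
Import numFieldNormedType.Exports.
Local Open Scope classical_set_scope.

(** The adic transformation has an explicit form. A path that is not maximal
    starts with a maximal word [v^k h^n] followed by its first non-maximal edge,
    and the transformation only changes that prefix:
<<
      v^k h^(n+1) v y  |->  h^n v^k d y
      v^k h^n d y      |->  h^n v^(k+1) h y
>>
    ([src], [tgt], [adic_src]). Both families of words are prefix codes, and
    they exhaust the path space up to a countable set. Hence a finite measure
    without atoms is invariant if and only if it is central, which means that the
    measure of a cylinder only depends on the vertex where its word ends
    ([central_invariant], [invariant_central]). A central measure is thus a
    nonnegative harmonic function on the quadrant, for the steps h, d and v.

    Ergodic measures have weights. If [mu] is invariant, ergodic and non-atomic,
    then for each edge [e] the measure [B |-> mu (e B)] is central, and it is
    bounded by [mu], because a central measure is invariant under the shift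
    ([central_shift]). It is therefore invariant, so it is a multiple of [mu] by
    ergodicity ([ergodic_dominated], a Hahn decomposition argument), that is,
    [mu (cylinder (e :: s)) = mu (cylinder [:: e]) * mu (cylinder s)]. The words
    [h v] and [d] end at the same vertex, whence the relation between the weights.

    Measures with weights are ergodic. If [A] is an invariant set, then
    [B |-> mu (B `&` A)] is again central. Dividing its values on cylinders by
    those of [mu] gives a bounded harmonic function for the random walk whose
    steps have the given weights. Such a function is constant
    ([bounded_harmonic_constant]), so [mu (B `&` A) = mu A * mu B] for all [B],
    and [B := A] gives [mu A = 0] or [mu A = 1].

    Existence comes from coding the points of the unit interval by paths: the
    points whose path starts with a given word form an interval whose length is
    the weight of the word ([code_preimage]). *)

Set Implicit Arguments.
Unset Strict Implicit.
Unset Printing Implicit Defensive.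

(** * Words, vertices and the explicit form of the adic transformation *)

(** Whether an edge increases the first, respectively the second, coordinate. *)
Definition hstep (e : edge) : bool := if e is Vertical then false else true.
Definition vstep (e : edge) : bool := if e is Horizontal then false else true.

(** The vertex reached from the root by following the edges of a word. *)
Definition endpoint (s : seq edge) : nat * nat :=
  (count hstep s, count vstep s).

(** The path that follows the word [s], then [y]. *)
Definition pre (s : seq edge) (y : dpath) : dpath :=
  fun i => if i < size s then nth Horizontal s i else y (i - size s).

(** The path obtained by forgetting the first [n] edges. *)
Definition shiftn (n : nat) (x : dpath) : dpath := fun i => x (n + i).

Lemma pre_ge s y i : pre s y (size s + i) = y i.
Proof. by rewrite /pre ltnNge leq_addr /= addKn. Qed.

Lemma pre_lt s y i : i < size s -> pre s y i = nth Horizontal s i.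
Proof. by rewrite /pre => ->. Qed.

Lemma pre0 y : pre [::] y = y.
Proof. by apply: funext => i; rewrite /pre /= subn0. Qed.

Lemma pre_cat s t y : pre (s ++ t) y = pre s (pre t y).
Proof.
apply: funext => i; rewrite /pre size_cat nth_cat.
case: (ltnP i (size s)) => hs; first by rewrite ltn_addr.
by rewrite ltn_subLR// subnDA.
Qed.

Lemma pre_rcons s e y : pre (rcons s e) y = pre s (pre [:: e] y).
Proof. by rewrite -cats1 pre_cat. Qed.

Lemma mkseq_pre s y : mkseq (pre s y) (size s) = s.
Proof.
apply: (@eq_from_nth _ Horizontal); rewrite size_mkseq// => i hi.
by rewrite nth_mkseq// pre_lt.
Qed.

Lemma pre_shiftn n x : pre (mkseq x n) (shiftn n x) = x.
Proof.
apply: funext => i; rewrite /pre size_mkseq /shiftn.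
by case: ltnP => h; [rewrite nth_mkseq|rewrite subnKC].
Qed.

Lemma shiftn_pre s y : shiftn (size s) (pre s y) = y.
Proof. by apply: funext => i; rewrite /shiftn pre_ge. Qed.

Lemma pre_inj s : injective (pre s).
Proof. by move=> y z /(congr1 (shiftn (size s))); rewrite !shiftn_pre. Qed.

Lemma endpoint_cat s t :
  endpoint (s ++ t) =
  ((endpoint s).1 + (endpoint t).1, (endpoint s).2 + (endpoint t).2).
Proof. by rewrite /endpoint !count_cat. Qed.

Lemma endpoint_rcons s e : endpoint (rcons s e) = target (endpoint s) e.
Proof.
by rewrite -cats1 endpoint_cat; case: e => /=;
  rewrite /endpoint /= ?addn0 ?addn1.
Qed.

Lemma vertexE x i : vertex x i = endpoint (mkseq x i).
Proof. by elim: i => // i IH; rewrite mkseqS endpoint_rcons /= IH. Qed.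

Lemma vertexD x i j : vertex x (i + j) =
  ((vertex x i).1 + (vertex (shiftn i x) j).1,
   (vertex x i).2 + (vertex (shiftn i x) j).2).
Proof.
rewrite !vertexE -endpoint_cat /mkseq iotaD map_cat add0n.
by congr (endpoint (_ ++ _)); rewrite -{1}[i]addn0 iotaDl -map_comp.
Qed.

Lemma vertex_pre s y i : vertex (pre s y) (size s + i) =
  ((endpoint s).1 + (vertex y i).1, (endpoint s).2 + (vertex y i).2).
Proof. by rewrite vertexD shiftn_pre (vertexE _ (size s)) mkseq_pre. Qed.

Lemma vertex_size_pre s y : vertex (pre s y) (size s) = endpoint s.
Proof. by rewrite vertexE mkseq_pre. Qed.

(** The sum of the coordinates of a vertex. It increases strictly along a path,
    so a path visits each vertex at most once. *)
Definition level (x : dpath) (i : nat) := (vertex x i).1 + (vertex x i).2.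

Lemma level_ltS x i : level x i < level x i.+1.
Proof. by rewrite /level /=; case: (x i) => /=; rewrite ?addnS// ltnS ltnW. Qed.

Lemma level_lt x : {mono (level x) : i j / i < j}.
Proof.
apply: leqW_mono; apply: leq_mono => i j lt_ij; rewrite -(subnKC lt_ij).
elim: (j - i.+1) => [|k IH]; last first.
  by apply: (ltn_trans IH); rewrite addnS; exact: level_ltS.
by rewrite addn0; exact: level_ltS.
Qed.

Lemma level_le x : {mono (level x) : i j / i <= j}.
Proof. by apply: leq_mono => i j; rewrite level_lt. Qed.

Lemma vertex_inj x : injective (vertex x).
Proof.
move=> i j eq_ij; apply/eqP.
by rewrite eqn_leq -(level_le x i j) -(level_le x j i) /level eq_ij leqnn.
Qed.

Lemma mergedC x y i j : merged x y i j -> merged y x j i.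
Proof. by case=> e1 e2; split. Qed.

Lemma merged_le x y i j i' j' :
  merged x y i j -> merged x y i' j' -> (i <= i') = (j <= j').
Proof.
by move=> [e _] [e' _]; rewrite -(level_le x i i') -(level_le y j j') /level e
  e'.
Qed.

Lemma mergedD x y i j k : merged x y i j -> merged x y (i + k) (j + k).
Proof.
case=> e1 e2; have ek : shiftn i x = shiftn j y by apply: funext => l;
  exact: e2.
split; first by rewrite !vertexD e1 ek.
by move=> l; rewrite -!addnA e2.
Qed.

(** Two paths that merge do so with a constant difference of indices. *)
Lemma merged_sub {x y i j i' j'} : merged x y i' j' -> merged x y i j ->
  i' <= i -> j = j' + (i - i').
Proof.
move=> m' m le_i; have [e _] := mergedD (i - i') m'.
by apply: (@vertex_inj y); rewrite -e subnKC//; case: m.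
Qed.

(** Paths that merge right after two different edges merge nowhere earlier. *)
Lemma adic_ltI x y i j :
  merged x y i.+1 j.+1 -> rank (x i) < rank (y j) -> adic_lt x y.
Proof.
move=> m lt_r; exists i, j; split=> // i' j' m'; rewrite ltnNge;
  apply/negP => le_i.
have := merged_sub m' m (leqW le_i); rewrite subSn// addnS => -[ej].
by case: m' => _ /(_ (i - i')); rewrite subnKC// -ej => e;
  rewrite e ltnn in lt_r.
Qed.

Lemma adic_lt_asym x y : adic_lt x y -> ~ adic_lt y x.
Proof.
move=> [i [j [m min lt_r]]] [i' [j' [m' min' lt_r']]].
have h1 := min _ _ (mergedC m'); have h2 := min' _ _ (mergedC m).
move: h1; rewrite (merged_le m (mergedC m')) => h3.
have ej : j.+1 = i'.+1 by apply/eqP; rewrite eqn_leq h2 h3.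
have ei : i.+1 = j'.+1.
  apply/eqP; rewrite eqn_leq (merged_le m (mergedC m')).
  by rewrite (merged_le (mergedC m') m) ej leqnn.
by case: ej ei lt_r lt_r' => -> [->] h /(ltn_trans h); rewrite ltnn.
Qed.

Lemma adic_lt_pre p q e f y :
  endpoint (rcons p e) = endpoint (rcons q f) -> rank e < rank f ->
  adic_lt (pre (rcons p e) y) (pre (rcons q f) y).
Proof.
move=> ee lt_r; apply: (@adic_ltI _ _ (size p) (size q)).
  split; first by rewrite -(size_rcons p e) -(size_rcons q f) !vertex_size_pre.
  by move=> k; rewrite -(size_rcons p e) -(size_rcons q f) !pre_ge.
by rewrite !pre_lt ?size_rcons// !nth_rcons !ltnn !eqxx.
Qed.

(** The minimal and the maximal word ending at [(n, k)]. *)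
Definition minw n k := nseq n Horizontal ++ nseq k Vertical.
Definition maxw n k := nseq k Vertical ++ nseq n Horizontal.

Lemma endpoint_minw n k : endpoint (minw n k) = (n, k).
Proof. by rewrite /endpoint /minw !count_cat !count_nseq /=; congr pair; lia.
Qed.

Lemma endpoint_maxw n k : endpoint (maxw n k) = (n, k).
Proof. by rewrite /endpoint /maxw !count_cat !count_nseq /=; congr pair; lia.
Qed.

Lemma nseqSr (T : Type) n (a : T) : nseq n.+1 a = rcons (nseq n a) a.
Proof. by elim: n => //= n ->. Qed.

Lemma minwS n k : minw n k.+1 = rcons (minw n k) Vertical.
Proof. by rewrite /minw nseqSr rcons_cat. Qed.

(** Among the words that end at [(n, k)], [minw n k] gives the least path. *)
Lemma minw_least q n k y : endpoint q = (n, k) ->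
  pre q y = pre (minw n k) y \/ adic_lt (pre (minw n k) y) (pre q y).
Proof.
elim/last_ind: q n k y => [|q f IH] n k y.
  by move=> [<- <-]; left.
move=> eq_nk; case: k eq_nk => [|k] eq_nk.
  case: n eq_nk => [|n] eq_nk; first by move: eq_nk; rewrite endpoint_rcons;
    case: f.
  have [ef eq] : f = Horizontal /\ endpoint q = (n, 0).
    move: eq_nk; rewrite endpoint_rcons; case: f => //= -[e1 e2]; split=> //.
    by rewrite /endpoint e1 e2.
  have -> : minw n.+1 0 = rcons (minw n 0) f by rewrite /minw !cats0 nseqSr ef.
  by rewrite !pre_rcons; exact: IH.
rewrite minwS; have [ef|nf] := pselect (f = Vertical).
  rewrite ef in eq_nk *; rewrite !pre_rcons; apply: IH.
  move: eq_nk; rewrite endpoint_rcons /= => -[e1 e2].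
  by rewrite /endpoint e1 e2.
right; apply: adic_lt_pre; first by rewrite -minwS endpoint_minw eq_nk.
by case: f nf {eq_nk}.
Qed.

(** The words that the adic transformation exchanges: [src c] is a maximal word
    followed by its first non-maximal edge, and [tgt c] is a minimal word
    followed by its first non-minimal edge. *)
Definition src (c : bool * (nat * nat)) : seq edge :=
  let: (b, (n, k)) := c in
  if b then rcons (maxw n.+1 k) Vertical else rcons (maxw n k) Diagonal.

Definition tgt (c : bool * (nat * nat)) : seq edge :=
  let: (b, (n, k)) := c in
  if b then rcons (minw n k) Diagonal else rcons (minw n k.+1) Horizontal.

Lemma endpoint_src_tgt c : endpoint (src c) = endpoint (tgt c).
Proof.
by case: c => [] [] [n k]; rewrite /src /tgt !endpoint_rcons endpoint_maxw
  endpoint_minw.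
Qed.

Lemma maxw_maximal n k y i : i < n + k ->
  maximal_edge (pre (maxw n k) y i) (vertex (pre (maxw n k) y) i.+1).
Proof.
move=> lt_i f; rewrite pre_lt; last by rewrite size_cat !size_nseq addnC.
rewrite nth_cat size_nseq; case: (ltnP i k) => [lt_ik|le_k].
  rewrite nth_nseq lt_ik /= /maxw => -[u].
  have -> : (target (vertex (pre (nseq k Vertical ++ nseq n Horizontal) y) i)
      (pre (nseq k Vertical ++ nseq n Horizontal) y i)) = (0, i.+1).
    have -> : nseq k Vertical ++ nseq n Horizontal =
        nseq i.+1 Vertical ++ (nseq (k - i.+1) Vertical ++ nseq n Horizontal).
      by rewrite catA -nseqD subnKC.
    rewrite -[LHS]/(vertex _ i.+1) pre_cat.
    have := vertex_size_pre (nseq i.+1 Vertical)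
      (pre (nseq (k - i.+1) Vertical ++ nseq n Horizontal) y).
    by rewrite size_nseq => ->; rewrite /endpoint !count_nseq /= mul0n mul1n.
  by case: f => //= -[].
by move=> _; rewrite nth_nseq; case: ifP; [|lia]; case: f.
Qed.

Lemma src_notin_max c y : ~ X_max (pre (src c) y).
Proof.
move=> /(_ (size (src c)).-1).
have sz : (size (src c)).-1.+1 = size (src c).
  by case: c => -[] [n k]; rewrite /src size_rcons.
rewrite sz vertex_size_pre -sz pre_lt ?sz// endpoint_src_tgt.
case: c {sz} => -[] [n k]; rewrite /src /tgt size_rcons nth_rcons ltnn eqxx
  endpoint_rcons.
  by move=> /(_ Diagonal)/(_ (ex_intro _ _ (erefl _))).
by move=> /(_ Horizontal)/(_ (ex_intro _ _ (erefl _))).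
Qed.

Lemma adic_lt_src_tgt c y : adic_lt (pre (src c) y) (pre (tgt c) y).
Proof.
have := endpoint_src_tgt c.
by case: c => -[] [n k] /= e; apply: adic_lt_pre.
Qed.

(** A path [z] above [src c] followed by [y] differs from it in an edge that is
    not maximal. If that edge comes after the word [src c], then [z] is above any
    path obtained by changing this prefix. If it is the last edge of [src c],
    then [z] is bounded below by the minimal word followed by the next edge. *)
Lemma src_successor c y : is_successor (pre (src c) y) (pre (tgt c) y).
Proof.
split; first exact: adic_lt_src_tgt.
move=> z [i [j [m _ lt_r]]].
have [p [e [n [k [es ep]]]]] : exists p e n k,
  src c = rcons p e /\ p = maxw n k.
  by case: (c) => -[] [n k] /=; do 4 eexists.
have szp : size p = n + k by rewrite ep size_cat !size_nseq addnC.
have szs : size (src c) = (n + k).+1 by rewrite es size_rcons szp.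
case: (ltngtP i (n + k)) => hi.
(* The edges of a maximal word cannot be replaced by higher ones. *)
- have := @maxw_maximal n k (pre [:: e] y) i hi.
  rewrite -ep -pre_rcons -es => /(_ (z j)) mx.
  move: lt_r; rewrite ltnNge mx//; exists (vertex z j).
  by case: m => ->.
- right; pose i' := size (tgt c) + (i - size (src c)).
  have ei : i = size (src c) + (i - size (src c)) by rewrite subnKC // szs.
  apply: (@adic_ltI _ _ i' j); last by rewrite pre_ge; move: lt_r;
    rewrite {1}ei pre_ge.
  case: m => m1 m2; split.
    rewrite -m1 ei -!addnS !vertex_pre; congr pair; rewrite endpoint_src_tgt.
      by do 3 congr addn; lia.
    by do 3 congr addn; lia.
  by move=> l; rewrite -m2 ei -!addnS -!addnA !pre_ge; congr y; lia.
- have ez : z = pre (rcons (mkseq z j) (z j)) y.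
    rewrite -mkseqS -{1}(pre_shiftn j.+1 z); congr pre.
    apply: funext => l; rewrite /shiftn; case: m => _ /(_ l) <-.
    by rewrite hi -szs pre_ge.
  have ed : endpoint (rcons (mkseq z j) (z j)) = endpoint (src c).
    rewrite -mkseqS -vertexE; case: m => <- _.
    by rewrite hi -szs vertex_size_pre.
  rewrite hi in lt_r; rewrite pre_lt ?szs// es nth_rcons szp ltnn eqxx in lt_r.
  rewrite ez; move: (mkseq z j) (z j) ed lt_r => q f ed lt_r {ez m hi}.
  have ed' := ed; rewrite endpoint_src_tgt in ed'.
  case: c szs ed ed' es => -[] [n' k'];
    rewrite /src /tgt => _ ed ed' /rcons_inj [_ ee].
    case: f ed ed' lt_r => ed ed'; rewrite -ee //= => _.
      by right; apply: adic_lt_pre.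
    rewrite !pre_rcons.
    apply: minw_least; move: ed'; rewrite !endpoint_rcons endpoint_minw /= =>
      -[h1 h2].
    by rewrite /endpoint h1 h2.
  case: f ed ed' lt_r => ed ed'; rewrite -ee //= => _.
  rewrite !pre_rcons.
  apply: minw_least; move: ed'; rewrite !endpoint_rcons endpoint_minw /= =>
    -[h1 h2].
  by rewrite /endpoint h1 h2.
Qed.

Lemma adic_src c y : adic (pre (src c) y) = pre (tgt c) y.
Proof.
rewrite /adic asboolF; last exact: src_notin_max.
case: xgetP => [z _ [lt_z min_z]|/(_ (pre (tgt c) y))]; last first.
  by move=> h; case: h; exact: src_successor.
have [lt_t min_t] := src_successor c y.
have [//|h1] := min_t _ lt_z.
by have [//|/adic_lt_asym] := min_z _ lt_t.
Qed.

Lemma adic_max x : X_max x -> adic x = x.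
Proof. by move=> h; rewrite /adic asboolT. Qed.

(** Every path is constant or has a maximal initial run of [a]. *)
Lemma runP a (x : dpath) :
  x = (fun=> a) \/ exists n y, x = pre (nseq n a) y /\ y 0 <> a.
Proof.
have [h|/existsNP h] := pselect (forall i, x i = a); [by left;
  apply: funext|right].
have ex : exists i, ~~ `[< x i = a >] by case: h => i h; exists i;
  rewrite asboolF.
have := ex_minnP ex; case=> n /asboolPn hn minn.
exists n, (shiftn n x); split; last by rewrite /shiftn addn0.
rewrite -{1}(pre_shiftn n x); congr pre.
apply: (@eq_from_nth _ a); rewrite size_mkseq ?size_nseq// => i lt_i.
rewrite nth_mkseq// nth_nseq lt_i.
by apply: contrapT => hi; have := minn i;
  rewrite asboolF// leqNgt lt_i => /(_ isT).
Qed.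

Lemma run_inj a n m (y z : dpath) : y 0 <> a -> z 0 <> a ->
  pre (nseq n a) y = pre (nseq m a) z -> n = m /\ y = z.
Proof.
wlog le_nm : n m y z / n <= m.
  move=> W hy hz e; case: (leqP n m) => [|/ltnW] le_nm;
    first exact: (W n m y z).
  by have [//|-> ->] := W m n z y le_nm hz hy.
move=> hy hz; rewrite -{1}(subnKC le_nm) nseqD pre_cat => /pre_inj.
case e : (m - n) => [|k]; last by move=> h; case: hy; rewrite h pre_lt.
by rewrite pre0 => ->; split=> //; lia.
Qed.

(** The constant path [a a a ...] and the paths [a^k b b b ...]; [None] stands
    for the constant path. For [a = v] and [b = h] this is [X_max]. *)
Definition exc (a b : edge) : set dpath :=
  range (fun o : option nat => if o is Some k then pre (nseq k a) (fun=> b)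
                               else (fun=> a)).

Lemma countable_exc a b : countable (exc a b).
Proof.
by apply: sub_countable (countableP [set: option nat]); exact: card_image_le.
Qed.

Lemma run2P a b (x : dpath) : exc a b x \/ exists k m y,
  [/\ x = pre (nseq k a ++ nseq m b) y, y 0 <> b & m = 0 -> y 0 <> a].
Proof.
have [->|[k [y [-> ya]]]] := runP a x; first by left; exists None.
have [->|[m [z [ez zb]]]] := runP b y; first by left; exists (Some k).
right; exists k, m, z; rewrite pre_cat -ez; split=> // m0.
by move: ya; rewrite ez m0 pre0.
Qed.

Lemma pre_head (y : dpath) : y = pre [:: y 0] (shiftn 1 y).
Proof. by rewrite -{1}(pre_shiftn 1 y). Qed.

Lemma srcP x : exc Vertical Horizontal x \/ exists c y, x = pre (src c) y.
Proof.
have [|[k [m [y [ex yb ya]]]]] := run2P Vertical Horizontal x; [by left|right].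
move: ex; rewrite (pre_head y) -pre_cat; case ey : (y 0) yb ya => // _ ya.
  by exists (false, (m, k)), (shiftn 1 y); rewrite /src -cats1.
case: m ya => [/(_ erefl)//|m] _.
by exists (true, (m, k)), (shiftn 1 y); rewrite /src -cats1.
Qed.

Lemma X_max_exc : X_max `<=` exc Vertical Horizontal.
Proof.
by move=> x mx; have [//|[c [y ex]]] := srcP x; case: (@src_notin_max c y);
  rewrite -ex.
Qed.

(** The word [tgt c] can be read off any path that it starts, from the lengths of
    its first two runs and the edge that follows them. *)
Lemma tgt_form c y : exists n m z, [/\ pre (tgt c) y = pre (nseq n Horizontal) 
   (pre (nseq m Vertical) z) , z 0 <> Vertical,
   pre (nseq m Vertical) z 0 <> Horizontal, z = pre [:: z 0] y &
   c = (if z 0 is Diagonal then (true,(n,m)) else (false,(n,m.-1)))].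
Proof.
case: c => -[] [n k].
  exists n, k, (pre [:: Diagonal] y); rewrite /tgt -cats1 pre_cat /minw pre_cat.
  by split=> //; case: k => [|k] //=; rewrite ?pre0 pre_lt.
exists n, k.+1, (pre [:: Horizontal] y);
  rewrite /tgt -cats1 pre_cat /minw pre_cat.
by split=> //; rewrite pre_lt.
Qed.

(** The words [tgt c] form a prefix code. *)
Lemma tgt_inj c c' y y' : pre (tgt c) y = pre (tgt c') y' -> c = c' /\ y = y'.
Proof.
move=> e; suff ec : c = c' by split=> //; rewrite ec in e; apply: pre_inj e.
have [n [m [z [e1 e2 e3 e4 e5]]]] := tgt_form c y.
have [n' [m' [z' [e1' e2' e3' e4' e5']]]] := tgt_form c' y'.
move: e; rewrite e1 e1' => /run_inj[]// en /run_inj[]// em ez.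
by rewrite e5 e5' en em ez.
Qed.

Lemma cylinderP s x : cylinder s x <-> exists y, x = pre s y.
Proof.
rewrite /cylinder /=; split=> [e|[y ->]]; last by rewrite mkseq_pre.
by exists (shiftn (size s) x); rewrite -{1}e pre_shiftn.
Qed.

Lemma exc_max : exc Vertical Horizontal `<=` X_max.
Proof.
move=> _ [[k|] _ <-] i.
  have -> : pre (nseq k Vertical) (fun=> Horizontal) =
      pre (maxw i.+1 k) (fun=> Horizontal).
    rewrite /maxw pre_cat; congr pre; apply: funext => j.
    by rewrite /pre; case: ifP => //; rewrite size_nseq nth_nseq => ->.
  by apply: maxw_maximal; rewrite addSn ltnS leq_addr.
have ev : (fun=> Vertical) = pre (maxw 0 i.+1) (fun=> Vertical).
  apply: funext => j.
  by rewrite /pre /maxw cats0; case: ifP => //;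
    rewrite size_nseq nth_nseq => ->.
by have := @maxw_maximal 0 i.+1 (fun=> Vertical) i (leqnn _); rewrite -ev.
Qed.

(** * The sigma-algebra of the path space *)

Lemma countable_word : countable [set: seq edge].
Proof.
pose f n := if n is 0 then Vertical else if n is 1 then Diagonal else
  Horizontal.
have -> : [set: seq edge] = map f @` [set: seq nat].
  apply/seteqP; split=> // s _; exists (map rank s) => //.
  by rewrite -map_comp map_id_in// => -[].
by apply: sub_countable (countableP [set: seq nat]); exact: card_image_le.
Qed.

Lemma cylinder_mkseq x n : cylinder (mkseq x n) x.
Proof. by rewrite /cylinder /= size_mkseq. Qed.

(** The cylinders, given as a subbase of the topology, form a base of it. *)
Lemma openP (A : set dpath) :
  open A <-> forall x, A x -> exists n, cylinder (mkseq x n) `<=` A.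
Proof.
split=> [[D' sD <-] x [U DU Ux]|h].
  have [F eU] : exists F : {fset seq edge},
    \bigcap_(s in [set` F]) cylinder s = U.
    by have [F _ eU] := sD _ DU; exists F.
  exists (\max_(s <- F) size s) => y; rewrite /cylinder /= size_mkseq => e.
  exists U => //; rewrite -eU => s /= sF.
  have le_s : size s <= \max_(t <- F) size t.
    by rewrite (big_rem s)//= leq_maxl.
  move: Ux; rewrite -eU => /(_ s sF); rewrite /cylinder /= => es.
  rewrite -[RHS]es; apply: (@eq_from_nth _ Horizontal);
    rewrite ?size_mkseq// => i lt_i.
  rewrite !nth_mkseq//; have lt_m := leq_trans lt_i le_s.
  by move/(congr1 (nth Horizontal ^~ i)): e; rewrite !nth_mkseq.
exists [set U | exists s, U = cylinder s /\ cylinder s `<=` A].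
  move=> _ [s [-> _]]; have es : \bigcap_(t in [set` [fset s]%fset]) cylinder t
    = cylinder s.
    by apply/seteqP; split=> [x /(_ s)|x xs t] /=; rewrite inE;
      [apply|move/eqP ->].
  by exists [fset s]%fset; [move=> t _; apply: mem_set|exact: es].
apply: (@etrans _ _ (\bigcup_(U in [set U | exists s, U = cylinder s /\
  cylinder s `<=` A]) U)) => //.
apply/seteqP; split=> [x [U [s [-> sA]]]|x Ax]; first exact: sA.
have [n hn] := h _ Ax; exists (cylinder (mkseq x n));
  first by exists (mkseq x n).
by rewrite /cylinder /= size_mkseq.
Qed.

Lemma measurable_cylinder s : measurable (cylinder s : set X).
Proof.
apply: sub_sigma_algebra; apply/openP => x xs; exists (size s).
by move: xs; rewrite /cylinder /= => ->.
Qed.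

(** The empty set is added to make the cylinders closed under intersection. *)
Definition cylinders : set (set X) :=
  [set set0] `|` range (cylinder : _ -> set X).

Lemma X_measurableE : @measurable _ X = <<s cylinders >>.
Proof.
apply/seteqP; split; apply: smallest_sub.
- exact: smallest_sigma_algebra.
- move=> A /openP oA.
  have -> : A = \bigcup_(s in [set s | cylinder s `<=` A]) cylinder s.
    apply/seteqP; split=> [x /oA[n sA]|x [s sA /sA]//].
    by exists (mkseq x n) => //; rewrite /cylinder/= size_mkseq.
  rewrite bigcup_mkcond.
  apply: (@countable_bigcupT_measurable _ (g_sigma_algebraType cylinders)).
    exact: countable_word.
  move=> s; case: ifP => _; last exact: measurable0.
  by apply: sub_sigma_algebra; right; exists s.
- exact: sigma_algebra_measurable.
- by move=> _ [->|[s _ <-]]; [exact: measurable0|exact: measurable_cylinder].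
Qed.

Lemma cylinder_nil : cylinder [::] = setT.
Proof. by apply/seteqP; split. Qed.

Lemma cylinder_pre s t y : size s <= size t -> cylinder s (pre t y) ->
  exists u, t = s ++ u.
Proof.
move=> le_st; rewrite /cylinder /= => es; exists (drop (size s) t).
rewrite -{1}(cat_take_drop (size s) t); congr (_ ++ _); rewrite -[RHS]es.
apply: (@eq_from_nth _ Horizontal); rewrite ?size_mkseq ?size_takel// => i lt_i.
by rewrite nth_mkseq// nth_take// pre_lt// (leq_trans lt_i).
Qed.

Lemma setI_cylinders : setI_closed cylinders.
Proof.
move=> _ B [->|[s _ <-]]; first by rewrite set0I; left.
case=> [->|[t _ <-]]; first by rewrite setI0; left.
wlog le_st : s t / size s <= size t.
  move=> W; case: (leqP (size s) (size t)) => [|/ltnW] h; first exact: W.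
  by rewrite setIC; exact: W.
have [->|/set0P[x [xs /cylinderP[y ex]]]] := eqVneq (cylinder s `&` cylinder t)
  set0.
  by left.
right; exists t => //; apply/esym/setIidPr => z /cylinderP[w ->].
move: xs; rewrite ex => /(cylinder_pre le_st)[u ->].
by apply/cylinderP; exists (pre u w); rewrite pre_cat.
Qed.

(** A finite measure is determined by its values on cylinders. *)
Lemma eq_measure_cylinder (R : realType)
    (m1 m2 : ({measure set X -> \bar R})%R) :
  (m1 setT < +oo)%E -> (forall s, m1 (cylinder s) = m2 (cylinder s)) ->
  forall A, measurable A -> m1 A = m2 A.
Proof.
move=> fin h; apply: (measure_unique cylinders (fun=> setT)) => //.
- exact: X_measurableE.
- exact: setI_cylinders.
- by move=> _; right; exists [::] => //; exact: cylinder_nil.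
- by rewrite bigcup_const.
- by move=> A [->|[s _ <-]]; rewrite ?measure0.
Qed.

(** Maps into the path space are measurable as soon as their coordinates are. *)
Lemma measurable_fun_path d (T : measurableType d) (f : T -> X) :
  (forall i e, measurable [set t | f t i = e]) -> measurable_fun setT f.
Proof.
move=> mf; apply: (measurability _ X_measurableE) => _ [A [->|[s _ <-]] <-].
  by rewrite preimage_set0 setI0.
rewrite setTI (_ : f @^-1` _ =
    \bigcap_(i in `I_(size s)) [set t | f t i = nth Horizontal s i]).
  by apply: fin_bigcap_measurable => // i _; exact: mf.
apply/seteqP; split=> [t|t h]; rewrite /cylinder /=.
  by move=> e i lt_i /=; rewrite -[in RHS]e nth_mkseq.
apply: (@eq_from_nth _ Horizontal); rewrite size_mkseq// => i lt_i.
by rewrite nth_mkseq//; exact: h.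
Qed.

Lemma measurable_coord i e : measurable ([set x | x i = e] : set X).
Proof.
have -> : [set x : X | x i = e] =
    \bigcup_(s in [set s | size s = i.+1 /\ nth Horizontal s i = e]) cylinder s.
  apply/seteqP; split=> [x xe|x [s [sz <-]]].
    exists (mkseq x i.+1); first by split;
      [exact: size_mkseq|rewrite nth_mkseq].
    exact: cylinder_mkseq.
  by rewrite /cylinder /= => xs; rewrite -[in RHS]xs nth_mkseq ?sz.
rewrite bigcup_mkcond; apply: countable_bigcupT_measurable => [|s].
  exact: countable_word.
by case: ifP => _ //; exact: measurable_cylinder.
Qed.

Lemma measurable_shiftn n : measurable_fun setT (shiftn n : X -> X).
Proof. by apply: measurable_fun_path => i e; exact: measurable_coord. Qed.

Lemma measurable_pre s : measurable_fun setT (pre s : X -> X).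
Proof.
apply: measurable_fun_path => i e; rewrite /pre; case: ltnP => _.
  have [->|ne] := pselect (nth Horizontal s i = e).
    by rewrite (_ : [set _ | _] = setT)//; apply/seteqP; split.
  by rewrite (_ : [set _ | _] = set0)//; apply/seteqP; split.
exact: measurable_coord.
Qed.

Lemma measurable_preimage_pre s (B : set X) :
  measurable B -> measurable (pre s @^-1` B : set X).
Proof. by move=> mB; rewrite -[X in measurable X]setTI; exact: measurable_pre.
Qed.

Lemma image_pre s (B : set X) :
  pre s @` B = cylinder s `&` shiftn (size s) @^-1` B.
Proof.
apply/seteqP; split=> [_ [y By <-]|x [/cylinderP[y ->]]] /=.
  by split; [apply/cylinderP; exists y|rewrite shiftn_pre].
by rewrite shiftn_pre => By; exists y.
Qed.

Lemma measurable_image_pre s (B : set X) :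
  measurable B -> measurable (pre s @` B : set X).
Proof.
move=> mB; rewrite image_pre; apply: measurableI;
  first exact: measurable_cylinder.
by rewrite -[X in measurable X]setTI; exact: measurable_shiftn.
Qed.

Lemma image_pre_cylinder s t : pre s @` cylinder t = cylinder (s ++ t).
Proof.
apply/seteqP; split=> [_ [y /cylinderP[z ->] <-]|x /cylinderP[z ->]].
  by apply/cylinderP; exists z; rewrite pre_cat.
by exists (pre t z); [apply/cylinderP; exists z|rewrite pre_cat].
Qed.

Lemma image_preT s : pre s @` setT = cylinder s.
Proof. by rewrite -cylinder_nil image_pre_cylinder cats0. Qed.

Lemma point_cylinders (x : X) : [set x] = \bigcap_n cylinder (mkseq x n).
Proof.
apply/seteqP; split=> [_ -> n _|y h]; first exact: cylinder_mkseq.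
apply: funext => i; have := h i.+1 I; rewrite /cylinder /mkset size_mkseq.
by move/(congr1 (nth Horizontal ^~ i)); rewrite !nth_mkseq.
Qed.

Lemma measurable_point (x : X) : measurable [set x].
Proof.
by rewrite point_cylinders; apply: bigcapT_measurable => n;
  exact: measurable_cylinder.
Qed.

Lemma measurable_countable (A : set X) : countable A -> measurable A.
Proof. by apply: countable_measurable => x; exact: measurable_point. Qed.

Lemma adic_preimage (A : set X) : adic @^-1` A =
  (X_max `&` A) `|` \bigcup_c (pre (src c) @` (pre (tgt c) @^-1` A)).
Proof.
apply/seteqP; split=> x /=.
  have [mx|nx] := pselect (X_max x); first by rewrite (adic_max mx); left.
  have [e|[c [y ->]]] := srcP x; last by rewrite adic_src => Ay; right;
    exists c => //; exists y.
  by case: nx; exact: exc_max.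
case=> [[mx Ax]|[c _ [y Ay <-]]]; first by rewrite (adic_max mx).
by rewrite adic_src.
Qed.

Lemma countable_X_max : countable X_max.
Proof. exact: sub_countable (subset_card_le X_max_exc) (countable_exc _ _). Qed.

Lemma countable_src : countable [set: bool * (nat * nat)].
Proof. exact: countableP. Qed.

Lemma measurable_adic : measurable_fun setT (adic : X -> X).
Proof.
move=> _ A mA; rewrite setTI adic_preimage; apply: measurableU.
  apply: measurable_countable; apply: sub_countable countable_X_max.
  by apply: subset_card_le => x [].
apply: countable_bigcupT_measurable => [|c]; first exact: countable_src.
by apply: measurable_image_pre; exact: measurable_preimage_pre.
Qed.

Local Open Scope ring_scope.

(** * Central measures and invariance *)

Section subtree.
Context (R : realType) (mu : {measure set X -> \bar R}) (s : seq edge).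

(** The measure that [mu] induces on the tails of the paths starting with [s]. *)
Definition subtree (B : set X) : \bar R := mu (pre s @` B).

Let subtree0 : subtree set0 = 0%E.
Proof. by rewrite /subtree image_set0 measure0. Qed.

Let subtree_ge0 B : (0 <= subtree B)%E.
Proof. exact: measure_ge0. Qed.

Let subtree_sigma_additive : semi_sigma_additive subtree.
Proof.
move=> F mF tF _; rewrite /subtree image_bigcup.
apply: measure_semi_sigma_additive.
- by move=> i; exact: measurable_image_pre.
- apply/trivIsetP => i j _ _ ij.
  rewrite -subset0 => x [[y Fy <-] [z Fz /pre_inj ez]]; rewrite {}ez in Fz.
  have : (F i `&` F j) y by split.
  by move/trivIsetP: tF => /(_ i j I I ij) ->.
- by apply: bigcupT_measurable => i; exact: measurable_image_pre.
Qed.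

HB.instance Definition _ :=
  isMeasure.Build _ X R subtree subtree0 subtree_ge0 subtree_sigma_additive.

End subtree.

Section central.
Context (R : realType).
Implicit Type mu : {measure set X -> \bar R}.

(** A measure is central when all cylinders given by paths from the root to the
    same vertex have the same measure. *)
Definition central (mu : set X -> \bar R) :=
  forall s t, endpoint s = endpoint t -> mu (cylinder s) = mu (cylinder t).

Lemma measure_mono mu (A B : set X) :
  measurable A -> measurable B -> A `<=` B -> (mu A <= mu B)%E.
Proof. by move=> mA mB; apply: le_measure; apply: mem_set. Qed.

(** In a central measure, prefixes with the same endpoint can be exchanged not
    only on cylinders but on all measurable sets. *)
Lemma central_swap mu s t (B : set X) : central mu -> (mu setT < +oo)%E ->
  endpoint s = endpoint t -> measurable B ->
  mu (pre s @` B) = mu (pre t @` B).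
Proof.
move=> cmu fin est mB.
apply: (@eq_measure_cylinder _ (subtree mu s : {measure set X -> \bar R})
  (subtree mu t : {measure set X -> \bar R})) => //.
  rewrite /= /subtree image_preT; apply: le_lt_trans fin.
  by apply: measure_mono => //; exact: measurable_cylinder.
move=> u; rewrite /= /subtree !image_pre_cylinder; apply: cmu.
by rewrite !endpoint_cat est.
Qed.

Lemma measure_setCD mu A : measurable A -> mu setT = (mu A + mu (~` A))%E.
Proof.
move=> mA; rewrite -measureU ?setUv ?setICr//; exact: measurableC.
Qed.

Lemma nonatomic_countable mu (A : set X) :
  (forall x, mu [set x] = 0%E) -> countable A -> mu A = 0%E.
Proof.
move=> na cA; have mA := measurable_countable cA.
apply/eqP; rewrite eq_le measure_ge0 andbT.
have [f /= inj] := elimT (countable_injP A) cA.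
pose F n : set X := [set x | A x /\ f x = n].
have F1 n : mu (F n) = 0%E.
  have [->|/set0P[x [Ax fx]]] := eqVneq (F n) set0; first exact: measure0.
  rewrite -(na x); congr (mu _); apply/seteqP; split=> [y [Ay fy]|_ ->//] /=.
  by apply: inj; [exact: mem_set|exact: mem_set|rewrite fx fy].
have mF n : measurable (F n).
  apply: measurable_countable; apply: sub_countable cA.
  by apply: subset_card_le => x [].
apply: (@le_trans _ _ (\sum_(n <oo) mu (F n))%E).
  by apply: measure_sigma_subadditive => // x Ax; exists (f x).
by rewrite eseries0// => n _ _; rewrite F1.
Qed.

(** The preimage of [A] is cut into countably many pieces, one for each word
    [src c], and each piece is sent to a disjoint piece of [A] by exchanging the
    prefixes [src c] and [tgt c]. *)
Lemma central_adic_le mu (A : set X) : central mu -> (mu setT < +oo)%E ->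
  (forall x, mu [set x] = 0%E) -> measurable A -> (mu (adic @^-1` A) <= mu A)%E.
Proof.
move=> cmu fin na mA.
pose piece (w : bool * (nat * nat) -> seq edge) n : set X :=
  if pickle_inv n is Some c then pre (w c) @` (pre (tgt c) @^-1` A) else set0.
have mpiece w n : measurable (piece w n).
  rewrite /piece; case: (pickle_inv n) => [c|]; last exact: measurable0.
  by apply: measurable_image_pre; exact: measurable_preimage_pre.
have eqp n : mu (piece src n) = mu (piece tgt n).
  rewrite /piece; case: (pickle_inv n) => [c|//].
  apply: central_swap => //; first exact: endpoint_src_tgt.
  exact: measurable_preimage_pre.
have tp : trivIset setT (piece tgt).
  apply/trivIsetP => i j _ _ /eqP ij; rewrite -subset0 => x [] /=.
  rewrite /piece; case ei : (pickle_inv i) => [c|//];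
    case ej : (pickle_inv j) => [c'|//].
  move=> [y _ <-] [z _ /tgt_inj[ec _]]; apply: ij.
  have := @pickle_invK (bool * (nat * nat))%type i; rewrite ei /= => <-.
  by have := @pickle_invK (bool * (nat * nat))%type j; rewrite ej /= => <-;
    rewrite ec.
have mN : measurable (X_max `&` A : set X).
  by apply: measurable_countable; apply: sub_countable countable_X_max;
    apply: subset_card_le => x [].
have N0 : mu (X_max `&` A) = 0%E.
  apply: nonatomic_countable => //; apply: sub_countable countable_X_max.
  by apply: subset_card_le => x [].
have -> : adic @^-1` A = (X_max `&` A) `|` \bigcup_n piece src n.
  rewrite adic_preimage; congr setU; apply/seteqP; split=> [x [c _ h]|x [n _]].
    by exists (choice.pickle c) => //; rewrite /piece pickleK_inv.
  by rewrite /piece; case: (pickle_inv n) => [c h|//]; exists c.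
have mU w : measurable (\bigcup_n piece w n) by exact: bigcupT_measurable.
have leU : (mu ((X_max `&` A) `|` \bigcup_n piece src n) <=
    mu (X_max `&` A) + mu (\bigcup_n piece src n))%E by exact: measureU2.
apply: (le_trans leU); rewrite N0 add0e.
apply: (@le_trans _ _ (\sum_(n <oo) mu (piece src n))%E).
  exact: measure_sigma_subadditive.
rewrite (eq_eseriesr (fun n _ => eqp n)) -measure_semi_bigcup//.
apply: measure_mono => // x [n _]; rewrite /piece.
by case: (pickle_inv n) => [c|//] [y Ay <-].
Qed.

Lemma measurable_adic_preimage (A : set X) : measurable A ->
  measurable (adic @^-1` A : set X).
Proof. by move=> mA; rewrite -[X in measurable X]setTI; exact: measurable_adic.
Qed.

(** The inequality for [A] and for its complement forces equality, since both
    sides have the same total mass. *)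
Lemma central_invariant mu (A : set X) : central mu -> (mu setT < +oo)%E ->
  (forall x, mu [set x] = 0%E) -> measurable A -> mu (adic @^-1` A) = mu A.
Proof.
move=> cmu fin na mA; apply/eqP; rewrite eq_le central_adic_le//=.
have mC := measurableC mA; have mA' := measurable_adic_preimage mA.
have le2 := central_adic_le cmu fin na mC.
have f2 B : measurable B -> mu B \is a fin_num.
  move=> mB; rewrite ge0_fin_numE//; apply: le_lt_trans fin.
  by apply: measure_mono.
have := measure_setCD mu mA; rewrite (measure_setCD mu mA') preimage_setC.
move: le2; rewrite preimage_setC.
have mC' := measurableC mA'.
rewrite -(fineK (f2 _ mA)) -(fineK (f2 _ mA')) -(fineK (f2 _ mC)).
rewrite -(fineK (f2 _ mC')).
rewrite -!EFinD !lee_fin => h1 [e]; lra.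
Qed.

Section invariant_central.
Variable mu : {measure set X -> \bar R}.
Hypothesis imu : forall A : set X, measurable A -> mu (adic @^-1` A) = mu A.
Hypothesis na : forall x, mu [set x] = 0%E.

(** Replacing the prefix [s] by [t] preserves the measure of cylinders. This is
    an equivalence relation, compatible with appending edges. *)
Definition exchangeable_words (s t : seq edge) :=
  forall u, mu (cylinder (s ++ u)) = mu (cylinder (t ++ u)).

Local Notation "s ~~~ t" := (exchangeable_words s t) (at level 70).

Lemma exw_sym s t : s ~~~ t -> t ~~~ s.
Proof. by move=> h u; rewrite h. Qed.

Lemma exw_trans s t w : s ~~~ t -> t ~~~ w -> s ~~~ w.
Proof. by move=> h h' u; rewrite h. Qed.

Lemma exw_rcons s t e : s ~~~ t -> rcons s e ~~~ rcons t e.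
Proof. by move=> h u; rewrite !cat_rcons. Qed.

(** The words [tgt c] form a prefix code, so up to a countable set the preimage
    of a cylinder starting with [tgt c] is the one starting with [src c]. *)
Lemma exw_src_tgt c : src c ~~~ tgt c.
Proof.
move=> u; rewrite -(imu (measurable_cylinder (tgt c ++ u))) adic_preimage.
have -> : \bigcup_c0
    (pre (src c0) @` (pre (tgt c0) @^-1` cylinder (tgt c ++ u))) = cylinder
      (src c ++ u).
  apply/seteqP.
  split=> [_ [c' _ [y /= /cylinderP[z ez] <-]]|_ /cylinderP[y ->]].
    move: ez; rewrite pre_cat => /tgt_inj[-> ->].
    by apply/cylinderP; exists z; rewrite pre_cat.
  exists c => //; exists (pre u y); last by rewrite pre_cat.
  by apply/cylinderP; exists y; rewrite pre_cat.
have cN : countable (X_max `&` cylinder (tgt c ++ u)).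
  by apply: sub_countable countable_X_max; apply: subset_card_le => x [].
rewrite setUC measureU0//;
  [exact: measurable_cylinder|exact: measurable_countable|].
exact: nonatomic_countable.
Qed.

(** By induction on the sum of the coordinates of the endpoint: all words
    ending at a given lower vertex are exchangeable, in particular the minimal
    and the maximal one, and the exchange of [src c] and [tgt c] links the three edges
    entering the vertex. *)
Lemma exw_minw s : s ~~~ minw (endpoint s).1 (endpoint s).2.
Proof.
have [N] := ubnP ((endpoint s).1 + (endpoint s).2)%N.
elim: N s => // N IH s le_N.
have max_min n k : (n + k < N)%N -> maxw n k ~~~ minw n k.
  by move=> h; have := IH (maxw n k); rewrite endpoint_maxw; apply.
have tgtT n k : (n.+1 + k < N)%N -> tgt (true, (n, k)) ~~~ minw n.+1 k.+1.
  move=> h; apply: exw_trans (exw_sym (exw_src_tgt _)) _.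
  by rewrite minwS; apply: exw_rcons; exact: max_min.
have tgtF n k : (n.+1 + k < N)%N -> tgt (false, (n, k)) ~~~ minw n.+1 k.+1.
  move=> h; apply: exw_trans (exw_sym (exw_src_tgt _)) _.
  apply: exw_trans (tgtT _ _ h); apply: exw_rcons; apply: max_min; lia.
elim/last_ind: s le_N => [//|s e _] le_N.
have IHs : s ~~~ minw (endpoint s).1 (endpoint s).2.
  apply: IH; move: le_N; rewrite endpoint_rcons; case: e => /=; lia.
apply: exw_trans (exw_rcons e IHs) _.
move: le_N; rewrite endpoint_rcons; case: (endpoint s) => n k /=.
case: e => /= le_N.
- case: k le_N {IHs} => [|k] le_N; last by apply: tgtF; lia.
  by rewrite /minw !cats0 nseqSr.
- by apply: tgtT; lia.
- by rewrite minwS.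
Qed.

Lemma invariant_central : central mu.
Proof.
move=> s t est; have := exw_minw s [::]; have := exw_minw t [::].
by rewrite !cats0 est => -> ->.
Qed.

End invariant_central.

End central.

(** * Measures dominated by an ergodic measure *)

Section dominated.
Context (R : realType).
Implicit Types (mu : probability X R) (m : {measure set X -> \bar R}).

Lemma fin_measure m (A : set X) :
  (m setT < +oo)%E -> measurable A -> m A \is a fin_num.
Proof.
by move=> fin mA; rewrite ge0_fin_numE//; apply: le_lt_trans fin;
  apply: measure_mono.
Qed.

Lemma fine_measureDI m (A B : set X) : (m setT < +oo)%E -> measurable A ->
  measurable B ->
  fine (m A) = fine (m (A `&` B)) + fine (m (A `\` B)).
Proof.
move=> fin mA mB; rewrite -fineD;
  [|apply: fin_measure => //|apply: fin_measure => //].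
- by rewrite addeC -measureDI.
- exact: measurableI.
- exact: measurableD.
Qed.

Section as_charge.
Context m (fin : (m setT < +oo)%E).

(** A finite measure on the path space, seen as a charge. *)
Definition as_charge : set X -> \bar R := let _ := fin in m.

Let as_charge0 : as_charge set0 = 0%E.
Proof. exact: measure0. Qed.

Let as_charge_fin A : measurable A -> as_charge A \is a fin_num.
Proof. exact: fin_measure. Qed.

Let as_charge_sigma_additive : semi_sigma_additive as_charge.
Proof. exact: measure_semi_sigma_additive. Qed.

HB.instance Definition _ := isCharge.Build _ X R as_charge
  as_charge0 as_charge_fin as_charge_sigma_additive.

End as_charge.

(** A Hahn decomposition for the difference of [m1] and [c] times [m2]. *)
Lemma Hahn_difference (m1 m2 : {measure set X -> \bar R}) (c : R) :
  (m1 setT < +oo)%E -> (m2 setT < +oo)%E ->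
  exists P : set X, measurable P /\
    (forall A, measurable A -> A `<=` P -> c * fine (m2 A) <= fine (m1 A)) /\
    (forall A, measurable A -> A `<=` ~` P -> fine (m1 A) <= c * fine (m2 A)).
Proof.
move=> fin1 fin2.
have [P [N [[mP posP] [mN negN] PN PN0]]] := Hahn_decomposition
  (cadd (as_charge fin1) (cscale (- c) (as_charge fin2))).
have E A : measurable A -> cadd (as_charge fin1)
    (cscale (- c) (as_charge fin2)) A =
    (fine (m1 A) - c * fine (m2 A))%:E.
  move=> mA; transitivity (m1 A + (- c)%:E * m2 A)%E; first by [].
  by rewrite EFinB EFinM EFinN mulNe !fineK//; exact: fin_measure.
exists P; split=> //; split=> A mA sA.
  by rewrite -subr_ge0 -lee_fin -(E _ mA); exact: posP.
have sN : A `<=` N.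
  by move=> x /sA nPx; have : [set: X] x by []; rewrite -PN => -[].
by rewrite -subr_le0 -lee_fin -(E _ mA); exact: negN.
Qed.

Lemma fine_cvg_bigcup m (F : nat -> set X) : (m setT < +oo)%E ->
  (forall n, measurable (F n)) -> nondecreasing_seq F ->
  fine (m (F n)) @[n --> \oo] --> fine (m (\bigcup_n F n)).
Proof.
move=> fin mF ndF; apply: fine_cvg.
rewrite fineK; last by apply: fin_measure => //; exact: bigcupT_measurable.
by apply: nondecreasing_cvg_mu => //; exact: bigcupT_measurable.
Qed.

Lemma fine_cvg_bigcap m (F : nat -> set X) : (m setT < +oo)%E ->
  (forall n, measurable (F n)) -> nonincreasing_seq F ->
  fine (m (F n)) @[n --> \oo] --> fine (m (\bigcap_n F n)).
Proof.
move=> fin mF niF; apply: fine_cvg.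
rewrite fineK; last by apply: fin_measure => //; exact: bigcapT_measurable.
apply: nonincreasing_cvg_mu => //; last exact: bigcapT_measurable.
by apply: le_lt_trans fin; exact: measure_mono.
Qed.

(** An invariant measure dominated by an ergodic one is a multiple of it: a
    Hahn set of the difference can be made strictly invariant, by taking the
    upper limit of its preimages, without changing the value of the
    difference. *)
Lemma ergodic_dominated mu m (A : set X) : invariant_measure mu ->
  ergodic_measure mu ->
  (forall B : set X, measurable B -> m (adic @^-1` B) = m B) ->
  (forall B : set X, measurable B -> (m B <= mu B)%E) -> measurable A ->
  m A = (m setT * mu A)%E.
Proof.
move=> imu emu im le_m mA.
have finmu : (mu setT < +oo)%E by rewrite probability_setT ltry.
have finm : (m setT < +oo)%E by apply: le_lt_trans (le_m _ _) finmu.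
pose c := fine (m setT).
(* The difference [s] of [m] and [c * mu] has total mass 0; [P] maximizes it. *)
have [P [mP [posP negP]]] := Hahn_difference c finm finmu.
pose s (B : set X) := fine (m B) - c * fine (mu B).
have sD (B C : set X) : measurable B -> measurable C ->
  s B = s (B `&` C) + s (B `\` C).
  move=> mB mC; rewrite /s (fine_measureDI finm mB mC) (fine_measureDI finmu mB
    mC); lra.
have s0 : s setT = 0 by rewrite /s probability_setT /= mulr1 subrr.
have s_max (B : set X) : measurable B -> s B <= s P.
  move=> mB; rewrite (sD _ _ mB mP) (sD _ _ mP mB) setIC.
  have : s (B `\` P) <= 0.
    by rewrite subr_le0; apply: negP; [exact: measurableD|exact: subDsetr].
  have : 0 <= s (P `\` B).
    by rewrite subr_ge0; apply: posP; [exact: measurableD|exact: subDsetl].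
  lra.
have s_adic (B : set X) : measurable B -> s (adic @^-1` B) = s B.
  by move=> mB; rewrite /s im// imu.
pose D n : set X := iter n (preimage adic) P.
have mD n : measurable (D n) by elim: n => //= n IH;
  exact: measurable_adic_preimage.
have sDn n : s (D n) = s P by elim: n => //= n IH; rewrite s_adic.
have s_union (B C : set X) : measurable B -> measurable C -> s B = s P ->
  s C = s P ->
    s (B `|` C) = s P.
  move=> mB mC sB sC; apply/eqP; rewrite eq_le s_max /=;
    last exact: measurableU.
  have mBC : measurable (B `|` C) by exact: measurableU.
  have := s_max _ (measurableI _ _ mB mC).
  rewrite (sD _ _ mBC mB) (sD _ _ mC mB) in sC *.
  have -> : (B `|` C) `&` B = B by rewrite setUK.
  have -> : (B `|` C) `\` B = C `\` B.
    by apply/seteqP; split=> x; rewrite /setD /setU/=; tauto.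
  rewrite sB (setIC B); lra.
pose V k n : set X := \bigcup_(i < n.+1) D (k + i)%N.
have mV k n : measurable (V k n) by apply: bigcup_measurable => i _.
have sV n : s (V 0%N n) = s P.
  elim: n => [|n IH]; first by rewrite /V bigcup_mkord big_ord1; exact: sDn.
  rewrite /V bigcup_mkord big_ord_recr -(bigcup_mkord _ (fun i => D (0 + i)%N)).
  apply: s_union; [exact: mV|exact: mD|exact: IH|exact: sDn].
pose U k : set X := \bigcup_i D (k + i)%N.
have mU k : measurable (U k) by exact: bigcupT_measurable.
have s_cvg (F : nat -> set X) (G : set X) : (fine (m (F n)) @[n --> \oo] -->
  fine (m G)) ->
    (fine (mu (F n)) @[n --> \oo] --> fine (mu G)) ->
    (forall n, s (F n) = s P) -> s G = s P.
  move=> c1 c2 sF.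
  have h : s (F n) @[n --> \oo] --> s G by apply: cvgB => //; apply: cvgMr.
  have h' : s (F n) @[n --> \oo] --> s P.
    by under eq_fun do rewrite sF; exact: cvg_cst.
  exact: (cvg_unique _ h h').
have UV : U 0%N = \bigcup_n V 0%N n.
  apply/seteqP; split=> x; first by move=> [i _ Di]; exists i => //;
    exists i => /=.
  by move=> [n _ [i _ Di]]; exists i.
have sU0 : s (U 0%N) = s P.
  have ndV : nondecreasing_seq (V 0%N).
    move=> i j ij; apply/subsetPset => x [l /= li Dl]; exists l => //=.
    exact: leq_trans li _.
  by rewrite UV; apply: s_cvg sV; apply: fine_cvg_bigcup.
have U_adic k : U k.+1 = adic @^-1` (U k) by rewrite /U preimage_bigcup.
have sU k : s (U k) = s P by elim: k => // k IH; rewrite U_adic s_adic.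
have niU : nonincreasing_seq U.
  apply/nonincreasing_seqP => k; apply/subsetPset => x [i _ Di].
  by exists i.+1 => //; rewrite addnS -addSn.
(* [Q] is the upper limit of the preimages of [P]. *)
pose Q : set X := \bigcap_k U k.
have mQ : measurable Q by exact: bigcapT_measurable.
have sQ : s Q = s P by apply: s_cvg sU; apply: fine_cvg_bigcap.
have QT : adic @^-1` Q = Q.
  rewrite /Q preimage_bigcap; apply/seteqP; split=> x h k _.
    case: k => [|k]; last by rewrite U_adic; exact: h.
    by have := h 0%N I; rewrite -U_adic; apply/subsetPset/niU.
  by rewrite -U_adic; exact: h.
(* By ergodicity [mu Q] is 0 or 1, and [s] vanishes on null sets of [mu]. *)
have sP0 : s P = 0.
  have null (B : set X) : measurable B -> mu B = 0%E -> s B = 0.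
    move=> mB B0; have := le_m _ mB; rewrite /s B0 measure_le0 => /eqP ->.
    by rewrite mulr0 subrr.
  rewrite -sQ; have [/null->//|Q1] := emu _ mQ QT.
  have mC : measurable (~` Q) by exact: measurableC.
  have C0 : mu (~` Q) = 0%E by rewrite probability_setC// Q1 subee.
  by have := sD _ _ measurableT mQ; rewrite s0 setTI setTD (null _ mC C0) addr0.
have s_le0 (B : set X) : measurable B -> s B <= 0 by rewrite -sP0; exact: s_max.
have : s A = 0.
  have h1 := s_le0 _ mA; have h2 := s_le0 _ (measurableC mA).
  have := sD _ _ measurableT mA; rewrite s0 setTI setTD; lra.
move/eqP; rewrite subr_eq0 => /eqP e.
by rewrite -(fineK (fin_measure finm mA)) e EFinM !fineK//; exact: fin_measure.
Qed.

End dominated.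

(** * Ergodic non-atomic measures are given by weights *)

Section splitting.
Context (R : realType).
Implicit Types (m : {measure set X -> \bar R}).

Lemma cylinder_rcons s e :
  cylinder (rcons s e) = cylinder s `&` [set x | x (size s) = e].
Proof.
apply/seteqP; split=> x.
  move/cylinderP=> [y ->]; split; first by apply/cylinderP; rewrite pre_rcons;
    eexists.
  by rewrite /= pre_lt ?size_rcons// nth_rcons ltnn eqxx.
by case; rewrite /cylinder /= => es e1; rewrite size_rcons mkseqS es e1.
Qed.

Lemma measure_split_coord m i (B : set X) : measurable B ->
  m B = (m (B `&` [set x | x i = Horizontal]) +
         m (B `&` [set x | x i = Diagonal]) +
         m (B `&` [set x | x i = Vertical]))%E.
Proof.
move=> mB; have mc e : measurable (B `&` [set x : X | x i = e]).
  by apply: measurableI => //; exact: measurable_coord.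
rewrite -measureU//; last first.
  by rewrite -subset0 => x [[_ /= ->] [_ /=]].
rewrite -measureU//; last 2 first.
- exact: measurableU.
- by rewrite -subset0 => x [[[_ /= ->]|[_ /= ->]] [_ /=]].
congr (m _); apply/seteqP; split=> [x Bx|x [[[]|[]]|[]]//].
by case e : (x i); [left; left|left; right|right].
Qed.

Lemma measure_cylinder_split m s : m (cylinder s) =
  (m (cylinder (rcons s Horizontal)) + m (cylinder (rcons s Diagonal)) +
   m (cylinder (rcons s Vertical)))%E.
Proof.
rewrite (measure_split_coord _ (size s)) ?cylinder_rcons//.
exact: measurable_cylinder.
Qed.

(** A central measure is invariant under the shift that forgets the first edge:
    moving the first edge to the end of a word does not change its endpoint. *)
Lemma central_shift m (B : set X) : central m -> (m setT < +oo)%E ->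
  measurable B ->
  m B = (subtree m [:: Horizontal] B + subtree m [:: Diagonal] B +
         subtree m [:: Vertical] B)%E.
Proof.
move=> cm fin mB.
have cmE s e : m (cylinder (rcons s e)) = subtree m [:: e] (cylinder s).
  rewrite /subtree image_pre_cylinder; apply: cm.
  by rewrite -cats1 !endpoint_cat /= addnC [X in (_, X)]addnC.
pose m1 e : {measure set X -> \bar R} := subtree m [:: e].
pose m12 : {measure set X -> \bar R} :=
  measure_add (m1 Horizontal) (m1 Diagonal).
pose m123 : {measure set X -> \bar R} := measure_add m12 (m1 Vertical).
have E C : m123 C = (m1 Horizontal C + m1 Diagonal C + m1 Vertical C)%E.
  transitivity (m12 C + m1 Vertical C)%E; first exact: measure_addE.
  by congr (_ + _)%E; exact: measure_addE.
rewrite -[RHS]E; apply: eq_measure_cylinder => // s.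
by rewrite measure_cylinder_split !cmE E.
Qed.

Lemma subtree_le m e (B : set X) : central m -> (m setT < +oo)%E ->
  measurable B ->
  (subtree m [:: e] B <= m B)%E.
Proof.
move=> cm fin mB; rewrite [leRHS](central_shift cm fin mB).
by case: e; rewrite ?leeDr// -?addeA ?leeDl// ?adde_ge0// addeCA leeDl//
  adde_ge0.
Qed.

Lemma subtree_central m e : central m -> central (subtree m [:: e]).
Proof.
by move=> cm s t est; rewrite /subtree !image_pre_cylinder; apply: cm;
  rewrite !endpoint_cat est.
Qed.

(** The measure of a point is the limit of those of its cylinders. *)
Lemma cvg_point m (x : X) : (m setT < +oo)%E ->
  fine (m (cylinder (mkseq x n))) @[n --> \oo] --> fine (m [set x]).
Proof.
move=> fin; rewrite point_cylinders; apply: fine_cvg_bigcap => //.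
  by move=> n; exact: measurable_cylinder.
apply/nonincreasing_seqP => n; apply/subsetPset.
by rewrite mkseqS cylinder_rcons => y [].
Qed.

Lemma weights_constant_path (mu : probability X R) a b c e :
  given_by_weights mu a b c -> weight a b c e = 1 ->
    mu [set (fun=> e) : X] = 1%E.
Proof.
move=> gw we1; have finmu : (mu setT < +oo)%E by rewrite probability_setT ltry.
have : fine (mu (cylinder (mkseq (fun=> e) n))) @[n --> \oo] -->
    fine (mu [set (fun=> e) : X]) by exact: cvg_point.
have E n : fine (mu (cylinder (mkseq (fun=> e) n))) = 1.
  rewrite gw /= big_map big_const_seq.
  by elim: (count _ _) => //= k ->; rewrite we1 mulr1.
under eq_fun do rewrite E.
move=> h; have e1 : fine (mu [set (fun=> e) : X]) = 1.
  exact: (cvg_unique _ h (cvg_cst _)).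
rewrite -e1 fineK//; apply: fin_measure => //; exact: measurable_point.
Qed.

End splitting.

Section ergodic_weights.
Context (R : realType).
Variable mu : probability X R.
Hypotheses (imu : invariant_measure mu) (emu : ergodic_measure mu).
Hypothesis na : nonatomic mu.

Let finmu : (mu setT < +oo)%E.
Proof. by rewrite probability_setT ltry. Qed.

Let cmu : central mu.
Proof. exact: invariant_central. Qed.

(** The measure of the paths starting with [e], transported to their tails, is
    invariant and at most [mu], so it is a multiple of [mu]. *)
Lemma ergodic_cylinder_cons e s :
  mu (cylinder (e :: s)) = (mu (cylinder [:: e]) * mu (cylinder s))%E.
Proof.
have mc := measurable_cylinder s.
rewrite -cat1s -image_pre_cylinder -(image_preT [:: e]).
apply: (@ergodic_dominated _ mu
  (subtree mu [:: e] : {measure set X -> \bar R})) => //.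
- move=> B mB; apply: central_invariant => //; first exact: subtree_central.
    by apply: le_lt_trans finmu; exact: subtree_le.
  move=> x; apply/eqP; rewrite eq_le measure_ge0 andbT -(na x).
  by apply: subtree_le => //; exact: measurable_point.
- by move=> B mB; exact: subtree_le.
Qed.

Lemma ergodic_given_by_weights : exists a b c : R,
  [/\ admissible a b c, 0 < a & given_by_weights mu a b c].
Proof.
pose w e := fine (mu (cylinder [:: e])).
have fm s : mu (cylinder s) \is a fin_num.
  by apply: fin_measure => //; exact: measurable_cylinder.
have wE : weight (w Diagonal) (w Horizontal) (w Vertical) = w.
  by apply: funext => -[].
have gw : given_by_weights mu (w Diagonal) (w Horizontal) (w Vertical).
  move=> s; rewrite wE; elim: s => [|e s IH].
    by rewrite cylinder_nil probability_setT big_nil.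
  by rewrite ergodic_cylinder_cons IH big_cons EFinM fineK.
have w0 e : 0 <= w e by rewrite fine_ge0.
have w1 : w Diagonal + w Horizontal + w Vertical = 1.
  have : mu (cylinder [::]) = (mu (cylinder [:: Horizontal]) +
      mu (cylinder [:: Diagonal]) + mu (cylinder [:: Vertical]))%E.
    exact: measure_cylinder_split.
  rewrite cylinder_nil probability_setT.
  rewrite -(fineK (fm [:: Horizontal])) -(fineK (fm [:: Diagonal])).
  rewrite -(fineK (fm [:: Vertical])).
  by rewrite -!EFinD => -[e1]; rewrite /w; lra.
have wM : w Horizontal * w Vertical = w Diagonal.
  have : mu (cylinder [:: Horizontal; Vertical]) =
    mu (cylinder [:: Diagonal]) by exact: cmu.
  rewrite ergodic_cylinder_cons -(fineK (fm [:: Horizontal])).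
  rewrite -(fineK (fm [:: Vertical])).
  by rewrite -(fineK (fm [:: Diagonal])) -EFinM => -[].
exists (w Diagonal), (w Horizontal), (w Vertical); split=> //.
rewrite lt_neqAle w0 andbT eq_sym; apply/eqP => d0.
have ne1 e : w e <> 1.
  (* A weight equal to 1 would make a constant path an atom. *)
  move=> we1; move: (na (fun=> e)); rewrite (weights_constant_path gw).
    by move/eqP; rewrite onee_eq0.
  by rewrite wE.
move/eqP: wM; rewrite d0 mulf_eq0 => /orP[]/eqP e0.
  by apply: (ne1 Vertical); move: w1; rewrite d0 e0; lra.
by apply: (ne1 Horizontal); move: w1; rewrite d0 e0; lra.
Qed.

End ergodic_weights.

(** * Measures given by positive weights are ergodic *)

Section liouville.
Context (R : realType) (w : edge -> R) (h : nat * nat -> R).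
Hypothesis w_gt0 : forall e, 0 < w e.
Hypothesis w_sum : w Horizontal + w Diagonal + w Vertical = 1.
Hypothesis h_bounded : forall z, 0 <= h z <= 1.
Hypothesis h_harmonic : forall z, h z = w Horizontal * h (target z Horizontal) +
  w Diagonal * h (target z Diagonal) + w Vertical * h (target z Vertical).

Lemma targetAC z e f : target (target z e) f = target (target z f) e.
Proof. by case: e; case: f. Qed.

(** Where a harmonic function is close to an upper bound, it is close to it at
    each neighbour as well. *)
Lemma harmonic_le_max (g : nat * nat -> R) M e z :
  (forall z, g z = w Horizontal * g (target z Horizontal) +
    w Diagonal * g (target z Diagonal) + w Vertical * g (target z Vertical)) ->
  (forall z, g z <= M) -> w e * (M - g (target z e)) <= M - g z.
Proof.
move=> hg gM; rewrite (hg z).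
have k f : 0 <= w f * (M - g (target z f)).
  by apply: mulr_ge0; [exact: ltW|rewrite subr_ge0].
by have := w_sum; case: e; have := k Horizontal; have := k Diagonal;
  have := k Vertical; nra.
Qed.

(** The increment [g] of [h] in the direction [e] is harmonic. If its supremum
    [M] were positive, it would be at least [M / 2] at [N] consecutive points in the
    direction [e], so [h] would grow by more than its bound. *)
Lemma harmonic_step_le e z : h (target z e) <= h z.
Proof.
pose g z := h (target z e) - h z; rewrite -subr_le0 -/(g z).
rewrite leNgt; apply/negP => gz.
have g_harm y : g y = w Horizontal * g (target y Horizontal) +
    w Diagonal * g (target y Diagonal) + w Vertical * g (target y Vertical).
  rewrite /g (h_harmonic y) (h_harmonic (target y e)) !(targetAC _ e); ring.
have sS : has_sup (range g).
  split; first by exists (g z), z.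
  exists 1 => _ [y _ <-]; rewrite /g.
  by have := h_bounded y; have := h_bounded (target y e); lra.
pose M := sup (range g).
have gM y : g y <= M by apply: ub_le_sup; [exact: sS.2|exists y].
have M0 : 0 < M by exact: lt_le_trans gz (gM z).
(* [N] steps with increments at least [M / 2] exceed the bound 1. *)
pose N := (Num.truncn (2 / M)).+1.
have NM : 2 < N%:R * M.
  by rewrite -ltr_pdivrMr//; exact: truncnS_gt.
have d0 : 0 < M / 2 * w e ^+ N by rewrite mulr_gt0 ?divr_gt0// exprn_gt0.
have [_ [y _ <-] gy] := sup_adherent d0 sS.
pose step j := iter j (target^~ e) y.
have le1 : w e <= 1.
  by have := w_sum; have := w_gt0 Horizontal; have := w_gt0 Diagonal;
    have := w_gt0 Vertical; case: e {g gz g_harm sS M gM M0 N NM d0 gy step} =>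
      /=; lra.
have bnd j : w e ^+ j * (M - g (step j)) <= M - g y.
  elim: j => [|j IH]; first by rewrite expr0 mul1r.
  apply: le_trans IH; rewrite exprSr -mulrA ler_wpM2l//.
    by rewrite exprn_ge0// ltW.
  exact: harmonic_le_max.
have half j : (j <= N)%N -> M / 2 <= g (step j).
  move=> jN; have p0 : 0 < w e ^+ j by rewrite exprn_gt0.
  have : w e ^+ j * (M - g (step j)) <= w e ^+ j * (M / 2).
    apply: (le_trans (bnd j)); apply: (@le_trans _ _ (M / 2 * w e ^+ N)).
      by move: gy; rewrite -/M; lra.
    rewrite mulrC; apply: ler_wpM2r; first by rewrite divr_ge0 ?ltW.
    by apply: ler_wiXn2l => //; exact: ltW.
  by rewrite ler_pM2l//; lra.
have grow j : (j <= N)%N -> j%:R * (M / 2) <= h (step j) - h y.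
  elim: j => [|j IH] jN; first by rewrite mul0r subrr.
  have := half _ (ltnW jN); have := IH (ltnW jN).
  by rewrite /g -[target (step j) e]/(step j.+1) -natr1 => h1 h2; nra.
have := grow N (leqnn N); have := h_bounded (step N); have := h_bounded y; nra.
Qed.

(** A bounded harmonic function for a random walk on the quadrant whose steps
    all have positive probability is constant: its value at a point is the mean
    of values that are not larger. *)
Lemma bounded_harmonic_constant z : h z = h (0, 0)%N.
Proof.
have step e y : h (target y e) = h y.
  have := harmonic_step_le Horizontal y; have := harmonic_step_le Diagonal y.
  have := harmonic_step_le Vertical y; have := h_harmonic y; have := w_sum.
  have := w_gt0 Horizontal; have := w_gt0 Diagonal; have := w_gt0 Vertical.
  move=> pV pD pH e1 eh lV lD lH.
  have qV : 0 <= w Vertical * (h y - h (target y Vertical)).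
    by apply: mulr_ge0; [exact: ltW|rewrite subr_ge0].
  have qH : 0 <= w Horizontal * (h y - h (target y Horizontal)).
    by apply: mulr_ge0; [exact: ltW|rewrite subr_ge0].
  have qD : 0 <= w Diagonal * (h y - h (target y Diagonal)).
    by apply: mulr_ge0; [exact: ltW|rewrite subr_ge0].
  have : w e * (h y - h (target y e)) = 0.
    have : w Horizontal * (h y - h (target y Horizontal)) +
        w Diagonal * (h y - h (target y Diagonal)) +
        w Vertical * (h y - h (target y Vertical)) = 0.
      rewrite !mulrBr [X in _ = X](_ : _ =
        (w Horizontal + w Diagonal + w Vertical) * h y - h y);
        last by rewrite e1 mul1r subrr.
      rewrite {5}eh; ring.
    by case: e; lra.
  by move/eqP; rewrite mulf_eq0 gt_eqF//= subr_eq0 => /eqP.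
case: z => n k; elim: n => [|n <-]; last exact: (step Horizontal (n, k)).
by elim: k => // k <-; exact: (step Vertical (0, k)%N).
Qed.

End liouville.

Section bernoulli.
Context (R : realType) (a b c : R).
Hypothesis adm : admissible a b c.

Lemma prod_weight s :
  \prod_(e <- s) weight a b c e = b ^+ (endpoint s).1 * c ^+ (endpoint s).2.
Proof.
case: adm => _ _ _ _ bc; elim: s => [|e s IH]; first by rewrite big_nil mulr1.
rewrite big_cons IH /=; case: e => /=; rewrite ?add0n ?exprS -?bc; ring.
Qed.

Section measure.
Variable mu : probability X R.
Hypothesis gw : given_by_weights mu a b c.

Lemma weights_central : central mu.
Proof. by move=> s t est; rewrite !gw !prod_weight est. Qed.

Hypothesis a_gt0 : 0 < a.

Lemma weight_gt0 e : 0 < weight a b c e.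
Proof.
case: adm => _ b0 c0 _ bc; have bn0 : b != 0 by apply/eqP => z; move: a_gt0;
  rewrite -bc z mul0r ltxx.
have cn0 : c != 0 by apply/eqP => z; move: a_gt0; rewrite -bc z mulr0 ltxx.
by case: e => //=; rewrite lt_neqAle eq_sym ?bn0 ?cn0.
Qed.

Lemma weights_nonatomic : nonatomic mu.
Proof.
move=> x; have finmu : (mu setT < +oo)%E by rewrite probability_setT ltry.
have := weight_gt0 Horizontal; have := weight_gt0 Diagonal;
  have := weight_gt0 Vertical.
move=> /= c0 a0 b0; have abc : a + b + c = 1 by case: adm.
pose q := Num.max a (Num.max b c).
have q0 : 0 <= q by rewrite !le_max (ltW a0).
have q1 : q < 1 by rewrite !gt_max; apply/and3P; split; lra.
have wq e : 0 <= weight a b c e <= q.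
  by rewrite (ltW (weight_gt0 e)) /q !le_max; case: e => /=; rewrite lexx ?orbT.
have bound n : fine (mu (cylinder (mkseq x n))) <= q ^+ n.
  rewrite gw /=; elim: n => [|n IH]; first by rewrite big_nil.
  rewrite mkseqS -cats1 big_cat /= big_seq1 exprSr.
  have /andP[h1 h2] := wq (x n); apply: ler_pM => //.
  by apply: prodr_ge0 => e _; have /andP[] := wq e.
have h1 : fine (mu (cylinder (mkseq x n))) @[n --> \oo] --> fine (mu [set x]).
  exact: cvg_point.
have h2 : q ^+ n @[n --> \oo] --> (0 : R) by apply: cvg_expr; rewrite ger0_norm.
have le0 : fine (mu [set x]) <= 0.
  by apply: ler_cvg_to h1 h2 _; exact: nearW.
have fx : mu [set x] \is a fin_num by apply: fin_measure => //;
  exact: measurable_point.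
by apply/eqP; rewrite eq_le measure_ge0 andbT -(fineK fx) lee_fin.
Qed.

Lemma weights_invariant : invariant_measure mu.
Proof.
have finmu : (mu setT < +oo)%E by rewrite probability_setT ltry.
move=> A mA; apply: central_invariant => //; first exact: weights_central.
exact: weights_nonatomic.
Qed.

(** The trace [m] of [mu] on an invariant set is central, and the quotient [h] of
    the values of [m] and [mu] on cylinders is a bounded harmonic function. *)
Lemma weights_ergodic : ergodic_measure mu.
Proof.
move=> A mA TA.
have finmu : (mu setT < +oo)%E by rewrite probability_setT ltry.
pose m : {measure set X -> \bar R} := mrestr mu mA.
have mE B : m B = mu (B `&` A) by [].
have le_m B : measurable B -> (m B <= mu B)%E.
  by move=> mB; apply: measure_mono => //; exact: measurableI.
have finm : (m setT < +oo)%E by apply: le_lt_trans (le_m _ _) finmu.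
have cm : central m.
  apply: invariant_central => [B mB|x].
    by rewrite !mE -{1}TA -preimage_setI weights_invariant//;
      exact: measurableI.
  by apply/eqP; rewrite eq_le measure_ge0 andbT -(weights_nonatomic x) le_m//;
    exact: measurable_point.
have fm s : m (cylinder s) \is a fin_num by apply: fin_measure => //;
  exact: measurable_cylinder.
pose phi z := fine (m (cylinder (minw z.1 z.2))).
have phiE s : fine (m (cylinder s)) = phi (endpoint s).
  by congr fine; apply: cm; rewrite endpoint_minw; case: (endpoint s).
pose h z := phi z / (b ^+ z.1 * c ^+ z.2).
have b0 := weight_gt0 Horizontal; have c0 := weight_gt0 Vertical.
rewrite /= in b0 c0.
have d0 z : 0 < b ^+ z.1 * c ^+ z.2 by rewrite mulr_gt0// exprn_gt0.
have hc : forall z, h z = h (0, 0)%N.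
  apply: (@bounded_harmonic_constant _ (weight a b c)) => /=.
  - exact: weight_gt0.
  - by case: adm => _ _ _ + _; lra.
  - move=> z; rewrite /h; apply/andP; split.
      by apply: divr_ge0; [exact: fine_ge0|exact: ltW].
    rewrite ler_pdivrMr// mul1r /phi.
    have -> : b ^+ z.1 * c ^+ z.2 = fine (mu (cylinder (minw z.1 z.2))).
      by rewrite gw prod_weight endpoint_minw.
    rewrite fine_le ?fin_measure//; try exact: measurable_cylinder.
    by apply: le_m; exact: measurable_cylinder.
  - move=> z; rewrite /h.
    have -> : phi z = phi (target z Horizontal) + phi (target z Diagonal)
        + phi (target z Vertical).
      rewrite -[z in LHS]/z (_ : z = endpoint (minw z.1 z.2)); last first.
        by rewrite endpoint_minw; case: z.
      rewrite -!endpoint_rcons -!phiE measure_cylinder_split.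
      by rewrite !fineD// fin_numD !fm.
    case: adm => _ _ _ _ <-; case: z => n k /=; rewrite !exprS.
    by field; rewrite !expf_neq0 ?gt_eqF.
have mmu s : m (cylinder s) = (m setT * mu (cylinder s))%E.
  rewrite -[LHS]fineK// phiE gw prod_weight -(fineK (fin_measure finm
    measurableT)).
  rewrite -EFinM; congr EFin.
  have -> : fine (m setT) = h (0, 0)%N by rewrite /h /phi /= cylinder_nil
    !expr0 mulr1 divr1.
  by rewrite -(hc (endpoint s)) /h divfK// gt_eqF.
have r0 : 0 <= fine (m setT) by rewrite fine_ge0.
have E : m A = (m setT * mu A)%E.
  rewrite -(fineK (fin_measure finm measurableT)).
  apply: (@eq_measure_cylinder _ m
    (mscale (NngNum r0) mu : {measure set X -> \bar R})) => // s.
  by rewrite mmu -{1}(fineK (fin_measure finm measurableT)).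
move: E; rewrite !mE setIid setTI.
rewrite -(fineK (fin_measure finmu mA)) -EFinM => -[/eqP].
rewrite -subr_eq0 -{1}[fine _]mulr1 -mulrBr mulf_eq0 subr_eq0 => /orP[]/eqP e.
  by left; rewrite e.
by right; rewrite -e.
Qed.

End measure.
End bernoulli.

(** * Existence of the measures given by weights *)

Section as_probability.
Context (R : realType) (m : {measure set X -> \bar R}) (m1 : m setT = 1%E).

(** A measure of total mass 1 on the path space, seen as a probability. *)
Definition as_probability : set X -> \bar R := let _ := m1 in m.

Let as_probability0 : as_probability set0 = 0%E.
Proof. exact: measure0. Qed.

Let as_probability_ge0 B : (0 <= as_probability B)%E.
Proof. exact: measure_ge0. Qed.

Let as_probability_sigma_additive : semi_sigma_additive as_probability.
Proof. exact: measure_semi_sigma_additive. Qed.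

HB.instance Definition _ := isMeasure.Build _ X R as_probability
  as_probability0 as_probability_ge0 as_probability_sigma_additive.

HB.instance Definition _ := Measure_isProbability.Build _ X R as_probability m1.

End as_probability.

Section coding.
Context (R : realType) (a b c : R).
Hypotheses (a0 : 0 <= a) (b0 : 0 <= b) (c0 : 0 <= c) (abc : a + b + c = 1).

(** The unit interval is cut into three consecutive intervals, of lengths [b]
    for h, [a] for d and [c] for v; [offset e] is the left end of the one of [e],
    [symbol u] the edge whose interval contains [u]. *)
Definition offset (e : edge) : R :=
  match e with Horizontal => 0 | Diagonal => b | Vertical => b + a end.

Definition symbol (u : R) : edge :=
  if u < b then Horizontal else if u < b + a then Diagonal else Vertical.

(** The affine map of the interval containing [u] onto the unit interval, for
    [u] in the unit interval. An interval of length 0 contains no point, so the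
    division is then not by 0. *)
Definition rescale (u : R) : R :=
  (u - offset (symbol u)) / weight a b c (symbol u).

(** The path whose edges are the symbols of the iterates of [rescale]. The points
    outside the unit interval, which carry no mass, are sent to a fixed path. *)
Definition code (u : R) : dpath :=
  fun n => if 0 <= u < 1 then symbol (iter n rescale u) else Horizontal.

(** The left end of the interval of the points whose path starts with a word. *)
Fixpoint left_end (s : seq edge) : R :=
  if s is e :: s' then offset e + weight a b c e * left_end s' else 0.

Let wt s := \prod_(e <- s) weight a b c e.

Lemma weight_ge0 e : 0 <= weight a b c e. Proof. by case: e. Qed.

Lemma wt_ge0 s : 0 <= wt s.
Proof. by apply: prodr_ge0 => e _; exact: weight_ge0. Qed.

Lemma symbolP u e : 0 <= u < 1 ->
  symbol u = e <-> offset e <= u < offset e + weight a b c e.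
Proof.
move=> /andP[u0 u1]; have [w1 wa wb wc] := And4 abc a0 b0 c0; split=> [<-|].
  by rewrite /symbol; case: ltP => h1; [|case: ltP => h2] => /=; apply/andP;
    split; lra.
by case: e => /= /andP[h1 h2]; rewrite /symbol; case: ltP => // h3;
  try case: ltP => // h4; exfalso; lra.
Qed.

Lemma left_end_ge0 s : 0 <= left_end s.
Proof.
elim: s => //= e s IH; apply: addr_ge0; last by rewrite mulr_ge0// weight_ge0.
by case: e => //=; exact: addr_ge0.
Qed.

Lemma right_end_le1 s : left_end s + wt s <= 1.
Proof.
elim: s => [|e s IH]; first by rewrite /wt big_nil add0r.
rewrite /wt big_cons /= -/(wt s) -addrA -mulrDr.
apply: (@le_trans _ _ (offset e + weight a b c e)).
  by rewrite lerD2l ler_piMr// weight_ge0.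
by have [w1 wa wb wc] := And4 abc a0 b0 c0; case: e => /=; lra.
Qed.

Lemma rescale_unit u : 0 <= u < 1 -> 0 <= rescale u < 1.
Proof.
move=> hu; have /andP[h1 h2] := (symbolP (symbol u) hu).1 erefl.
have w0 : 0 < weight a b c (symbol u) by lra.
by rewrite /rescale divr_ge0 ?subr_ge0 ?(ltW w0)//= ltr_pdivrMr// mul1r ltrBlDl.
Qed.

Lemma code_cons u : 0 <= u < 1 -> code u = pre [:: symbol u] (code (rescale u)).
Proof.
move=> hu; apply: funext => -[|n]; rewrite /pre /code hu//= subn1/=.
by rewrite rescale_unit// -iterSr.
Qed.

Lemma code_cylinder s u : 0 <= u < 1 ->
  cylinder s (code u) <-> left_end s <= u < left_end s + wt s.
Proof.
elim: s u => [|e s IH] u hu.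
  by rewrite cylinder_nil /wt big_nil add0r hu.
rewrite /wt big_cons /= -/(wt s).
have -> : cylinder (e :: s) (code u) <->
    symbol u = e /\ cylinder s (code (rescale u)).
  rewrite (code_cons hu); split.
    move/cylinderP => [y ey].
    have e1 : symbol u = e by have := congr1 (@^~ 0%N) ey.
    split=> //; apply/cylinderP; exists y; apply: (@pre_inj [:: e]).
    by rewrite -pre_cat -{1}e1.
  move=> [-> /cylinderP[y ->]]; apply/cylinderP; exists y.
  by rewrite -pre_cat.
rewrite (IH _ (rescale_unit hu)).
have := left_end_ge0 s; have := right_end_le1 s; have := wt_ge0 s => w0 r1 l0.
split=> [[e1]|].
  have /andP[h1 h2] := (symbolP e hu).1 e1.
  have we0 : 0 < weight a b c e by lra.
  rewrite /rescale e1 ler_pdivlMr// ltr_pdivrMr// => /andP[h3 h4].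
  by apply/andP; split; nra.
move=> /andP[h1 h2].
have we0 := weight_ge0 e.
have e1 : symbol u = e by apply/symbolP => //; apply/andP; split; nra.
have /andP[h3 h4] := (symbolP e hu).1 e1.
have {}we0 : 0 < weight a b c e by lra.
split=> //; rewrite /rescale e1 ler_pdivlMr// ltr_pdivrMr//.
by apply/andP; split; nra.
Qed.

Let unitI : set (measurableTypeR R) := `[0, 1[%classic.

Lemma measurable_unitI : measurable unitI.
Proof. exact: measurable_itv. Qed.

Lemma code_preimage s : code @^-1` cylinder s `&` unitI =
  `[left_end s, left_end s + wt s[%classic.
Proof.
apply/seteqP; split=> u /=; rewrite /unitI /= !in_itv /=.
  by move=> [h hu]; apply/(code_cylinder s hu).
move=> hu; have hu1 : 0 <= u < 1.
  by have := left_end_ge0 s; have := right_end_le1 s; lra.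
by split=> //; apply/(code_cylinder s hu1).
Qed.

Lemma measurable_code : measurable_fun setT (code : measurableTypeR R -> X).
Proof.
apply: (measurability _ X_measurableE) => _ [A [->|[s _ <-]] <-].
  by rewrite preimage_set0 setI0; exact: measurable0.
rewrite setTI -(setUIDK (code @^-1` cylinder s) unitI) code_preimage.
apply: measurableU; first exact: measurable_itv.
have [h|h] := pselect (cylinder s (fun=> Horizontal)).
  have -> : code @^-1` cylinder s `\` unitI = ~` unitI.
    apply/seteqP; split=> u; first by case.
    rewrite /unitI /= in_itv /= => nu; split; last by [].
    by rewrite /code (negbTE (introN idP nu)).
  by apply: measurableC; exact: measurable_unitI.
have -> : code @^-1` cylinder s `\` unitI = set0.
  rewrite -subset0 => u; rewrite /unitI /= in_itv /= => -[+ nu].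
  by rewrite /code (negbTE (introN idP nu)).
exact: measurable0.
Qed.

Lemma bernoulli_exists : exists mu : probability X R, given_by_weights mu a b c.
Proof.
have mU := measurable_unitI.
have [m mE] : exists m : {measure set X -> \bar R}, forall B : set X,
    m B = lebesgue_measure (code @^-1` B `&` unitI).
  unshelve eexists (pushforward (mrestr lebesgue_measure mU)
    (code : measurableTypeR R -> X) : {measure set X -> \bar R}).
    exact: measurable_code.
  by [].
have gm s : m (cylinder s) = (wt s)%:E.
  rewrite mE code_preimage lebesgue_measure_itv /= lte_fin ltrDl.
  rewrite -EFinD addrAC subrr add0r; case: ltP => // h.
  by congr EFin; apply/eqP; rewrite eq_le h wt_ge0.
have m1 : m setT = 1%E by rewrite -cylinder_nil gm /wt big_nil.
by exists (as_probability m1).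
Qed.

End coding.

(** * Degenerate weights and the classification *)

Section degenerate.
Context (R : realType).
Implicit Type mu : probability X R.

Lemma X_max_constant e : e <> Diagonal -> X_max (fun=> e).
Proof.
case: e => // _; apply: exc_max; last by exists None.
by exists (Some 0%N) => //; exact: pre0.
Qed.

Lemma point_mass mu x (A : set X) : mu [set x] = 1%E -> measurable A ->
  mu A = (`[< A x >]%:R)%:E.
Proof.
move=> x1 mA; have mx := measurable_point x.
have full B : measurable B -> B x -> mu B = 1%E.
  move=> mB Bx; apply/eqP; rewrite eq_le probability_le1//= -x1.
  by apply: measure_mono => // y ->.
case: asboolP => [/full->//|nAx]; rewrite -[A]setCK probability_setC;
  last exact: measurableC.
by rewrite full ?subee//; exact: measurableC.
Qed.

Lemma point_mass_ergodic mu x : X_max x -> mu [set x] = 1%E ->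
  [/\ invariant_measure mu, ergodic_measure mu & ~ nonatomic mu].
Proof.
move=> mx x1; split=> [A mA|A mA _|na].
- rewrite !(point_mass x1)//; last exact: measurable_adic_preimage.
  by rewrite /preimage/= adic_max.
- by rewrite (point_mass x1 mA); case: asbool; [right|left].
- by move: x1; rewrite na => -[/eqP]; rewrite eq_sym oner_eq0.
Qed.

End degenerate.

Unset Implicit Arguments.

Theorem theorem2p2 (R : realType) :
  [/\ (* each admissible triple of weights gives exactly one measure *)
      forall a b c : R, admissible a b c ->
        exists mu : probability X R, given_by_weights mu a b c /\
          forall nu : probability X R, given_by_weights nu a b c ->
            forall A : set X, measurable A -> nu A = mu A,
      (* the non-atomic ergodic measures are the members of this family,
         its two degenerate members (alpha = 0) being excluded *)
      forall mu : probability X R,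
        [/\ invariant_measure mu, ergodic_measure mu & nonatomic mu] <->
        exists a b c : R,
          [/\ admissible a b c, 0 < a & given_by_weights mu a b c],
      (* the degenerate members are ergodic but not non-atomic *)
      forall (mu : probability X R) (b c : R),
        admissible 0 b c -> given_by_weights mu 0 b c ->
        [/\ invariant_measure mu, ergodic_measure mu & ~ nonatomic mu],
      (* the family has one parameter in [0, 1], the horizontal weight ... *)
      forall b : R, 0 <= b <= 1 -> exists! p : R * R, admissible p.1 b p.2
      (* ... and distinct triples give distinct measures *)
    & forall (mu : probability X R) (a b c a' b' c' : R),
        given_by_weights mu a b c -> given_by_weights mu a' b' c' ->
        [/\ a = a', b = b' & c = c']].
Proof.
split.
- move=> a b c [a0 b0 c0 abc _].
  have [mu gmu] := bernoulli_exists a0 b0 c0 abc.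
  exists mu; split=> // nu gnu A mA; apply: eq_measure_cylinder => //.
    by change (nu setT < +oo)%E; rewrite probability_setT ltry.
  by move=> s; change (nu (cylinder s) = mu (cylinder s)); rewrite gmu gnu.
- move=> mu; split=> [[imu emu na]|[a [b [c [adm a0 gw]]]]].
    exact: ergodic_given_by_weights.
  split; first exact: (weights_invariant adm gw).
    exact: (weights_ergodic adm gw).
  exact: (weights_nonatomic adm gw).
- move=> mu b c [_ b0 c0 bc /eqP]; rewrite mulf_eq0 => /orP[]/eqP z gw.
    apply: (@point_mass_ergodic _ mu (fun=> Vertical));
      first exact: X_max_constant.
    by apply: (weights_constant_path gw) => /=; lra.
  apply: (@point_mass_ergodic _ mu (fun=> Horizontal));
    first exact: X_max_constant.
  by apply: (weights_constant_path gw) => /=; lra.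
- move=> b /andP[b0 b1]; have b10 : 1 + b != 0 by lra.
  pose c := (1 - b) / (1 + b).
  have ec : c * (1 + b) = 1 - b by rewrite divfK.
  have c0 : 0 <= c by rewrite divr_ge0//; lra.
  exists (b * c, c); split=> [|[a' c'] [/= a0 _ c0' abc bc]].
    by split=> //=; [exact: mulr_ge0|lra].
  have e : c' = c by apply: (mulIf b10); rewrite ec; lra.
  by rewrite -bc e.
- move=> mu a b c a' b' c' gw gw'.
  have E e : weight a b c e = weight a' b' c' e.
    by have := gw [:: e]; rewrite gw' !big_seq1 => -[].
  by split; [exact: (E Diagonal)|exact: (E Horizontal)|exact: (E Vertical)].
Qed.
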